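(* Let $\Lambda\subset\mathbb R^{2n}$ be a lattice, let $\Lambda_{\mathbb C}=\{x+i\xi\in\mathbb C^n:(\xi,x)\in\Lambda\}$, and let $\omega$ be the Kähler metric on the torus $\mathbb C^n/\Lambda_{\mathbb C}$ induced by the standard Kähler metric $dd^c\pi|z|^2$ of $\mathbb C^n$. If $\lambda_0(\mathbb C^n/\Lambda_{\mathbb C},\omega)<1$, then $\Lambda_{\mathbb C}$ is a set of uniqueness for $\mathcal F^\infty$.
   Context: $dd^c:=\frac{i}{2\pi}\partial\overline\partial$. For a Kähler manifold $(X,\omega)$, $\mathrm{PSH}(X,\omega)$ is the space of $\omega$-plurisubharmonic functions, i.e. functions $\phi:X\to[-\infty,\infty)$, upper semicontinuous and not identically $-\infty$, such that for every local potential $\psi$ of $\omega$ ($\omega=dd^c\psi$), $\phi+\psi$ is subharmonic on each holomorphic disk embedded in $X$. The Lelong number of $\phi$ at $x$ is $\nu_x(\phi):=\liminf_{z\to0}\frac{\phi(z)}{\log|z|^2}$, where $z$ is a holomorphic coordinate chart around $x$ with $z(x)=0$. The pseudoeffective threshold at $x$ is $$\lambda_x(X,\omega):=\sup\{\gamma\ge0:\exists\,\phi\in\mathrm{PSH}(X,\omega),\ \nu_x(\phi)\ge\gamma\}.$$ $0$ denotes the image of the origin in the torus. $\Lambda_{\mathbb C}$ is a set of uniqueness for $\mathcal F^\infty$ if every holomorphic function $F$ on $\mathbb C^n$ with $\sup_{z\in\mathbb C^n}|F(z)|^2e^{-\pi|z|^2}\le1$ and $F|_{\Lambda_{\mathbb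 C}}=0$ is identically $0$. *)

(* Defs.v *)
From HB Require Import structures.
From mathcomp Require Import all_boot all_order all_algebra generic_quotient.
From mathcomp Require Import complex ring.
From mathcomp Require Import all_classical all_reals all_analysis.

Set Implicit Arguments.
Unset Strict Implicit.
Unset Printing Implicit Defensive.

Import Order.TTheory GRing.Theory Num.Theory numFieldNormedType.Exports.

Local Open Scope classical_set_scope.
Local Open Scope ring_scope.
Local Open Scope quotient_scope.

(* [R[i]] is not itself recognized as a normed space by the topological
   hierarchy; stating it as an element of [numClosedFieldType] gives [Cplx R]
   and ['rV[Cplx R]_n] their usual topology and normed structure, so that
   [differentiable] below means complex (Frechet) differentiable. *)
Definition Cplx (R : realType) : numClosedFieldType := complex R.

Section ComplexSpace.
Context {R : realType}.
Local Notation C := (Cplx R).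

Definition toC (x : R) : C := Complex x 0.
Definition ReC (z : C) : R := complex.Re z.
Definition ImC (z : C) : R := complex.Im z.
Definition IC : C := Complex 0 1.

(* Euclidean |z|^2, not the square of the (sup) norm of ['rV[C]_n] *)
Definition sqnorm {n} (z : 'rV[C]_n) : R :=
  \sum_j (ReC (z 0 j) ^+ 2 + ImC (z 0 j) ^+ 2).

Definition open_disk (a : C) (r : R) : set C := [set w | `|w - a| < toC r].
Definition closed_disk (a : C) (r : R) : set C := [set w | `|w - a| <= toC r].
Definition circle_point (a : C) (r t : R) : C :=
  a + toC r * Complex (cos t) (sin t).

Section Forms.
Context {n : nat}.
Implicit Types (u : 'rV[C]_n -> R) (f : 'rV[C]_n -> C) (v z : 'rV[C]_n).

Definition line u z v : R -> R := fun t => u (z + toC t *: v).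
Definition dir_deriv v u z : R := derive1 (line u z v) 0.

Fixpoint Ck_on (k : nat) (U : set 'rV[C]_n) u : Prop :=
  (forall z, U z -> {for z, continuous u}) /\
  if k is k'.+1 then
    forall v, (forall z, U z -> derivable (line u z v) 0 1) /\
              Ck_on k' U (dir_deriv v u)
  else True.

Definition smooth_on (U : set 'rV[C]_n) u : Prop := forall k, Ck_on k U u.

Definition dir_derivC v f z : C :=
  Complex (dir_deriv v (ReC \o f) z) (dir_deriv v (ImC \o f) z).

Definition unit_vec (j : 'I_n) : 'rV[C]_n := delta_mx 0 j.

Definition d_z (j : 'I_n) f z : C :=
  2^-1 * (dir_derivC (unit_vec j) f z - IC * dir_derivC (IC *: unit_vec j) f z).
Definition d_zbar (j : 'I_n) f z : C :=
  2^-1 * (dir_derivC (unit_vec j) f z + IC * dir_derivC (IC *: unit_vec j) f z).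

(* A (1,1)-form is represented by the matrix of its coefficients on
   dz_j /\ d(conj z_k); this is  (i / 2 pi) \partial \bar\partial u. *)
Definition ddc u z : 'M[C]_n :=
  \matrix_(j, k) (IC / toC (2 * pi) * d_z j (d_zbar k (toC \o u)) z).

Definition std_kahler : 'rV[C]_n -> 'M[C]_n := ddc (fun z => pi * sqnorm z).

End Forms.

Section UpperSemicontinuous.
Local Open Scope ereal_scope.

Definition usc_at (T : topologicalType) (f : T -> \bar R) (x : T) : Prop :=
  forall a : R, f x < a%:E -> \forall y \near x, f y < a%:E.

(* The function identically -oo is allowed: this is what is needed for
   restrictions of plurisubharmonic functions to disks. *)
Definition subharmonic_on (U : set C) (u : C -> \bar R) : Prop :=
  [/\ forall w, U w -> u w < +oo,
      forall w, U w -> usc_at u w &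
      forall (a : C) (r : R), (0 < r)%R -> closed_disk a r `<=` U ->
        u a <= ((2 * pi)^-1)%:E *
               \int[lebesgue_measure]_(t in `[0%R, (2 * pi)%R])
                 u (circle_point a r t)].

End UpperSemicontinuous.
End ComplexSpace.

Section StdKahler.
Context {R : realType} {n : nat}.
Local Notation C := (Cplx R).
Implicit Types (v z : 'rV[C]_n).

Let inner v z : R :=
  \sum_j (ReC (v 0 j) * ReC (z 0 j) + ImC (v 0 j) * ImC (z 0 j)).

Lemma dir_deriv_quadratic v u z (a b c : R) :
  line u z v =1 (fun t => a + b * t + c * t ^+ 2) -> dir_deriv v u z = b.
Proof.
move=> /funext e; rewrite /dir_deriv e derive1E.
have -> : (fun t : R => a + b * t + c * t ^+ 2) =
  (cst a + b *: id + c *: (id ^+ 2)) :> (R -> R) by [].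
have h : is_derive (0 : R) 1 (cst a + b *: id + c *: (id ^+ 2)) b.
  by apply: is_derive_eq; rewrite /= /GRing.scale /=; ring.
exact: derive_val.
Qed.

Lemma dir_deriv_sqnorm v z :
  dir_deriv v (fun z => pi * sqnorm z) z = 2 * pi * inner v z.
Proof.
apply: (@dir_deriv_quadratic _ _ _ (pi * sqnorm z) _ (pi * sqnorm v)) => t.
rewrite /line /sqnorm /inner !mulr_sumr !mulr_suml -!big_split /=.
apply: eq_bigr => j _; rewrite !mxE.
case: (z 0 j) => x y; case: (v 0 j) => p q /=.
rewrite /ReC /ImC /=; ring.
Qed.

Lemma inner_unit_vec (w : C) j z :
  inner (w *: unit_vec j) z = ReC w * ReC (z 0 j) + ImC w * ImC (z 0 j).
Proof.
rewrite /inner (bigD1 j) //= big1 ?addr0 => [|i ij]; rewrite !mxE eqxx ?eqxx.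
  by rewrite mulr1.
by rewrite (negbTE ij) mulr0 /ReC /ImC /= !mul0r addr0.
Qed.

Lemma dir_derivC_sqnorm v z :
  dir_derivC v (toC \o (fun z => pi * sqnorm z)) z = toC (2 * pi * inner v z).
Proof.
rewrite /dir_derivC dir_deriv_sqnorm; congr Complex.
by apply: (@dir_deriv_quadratic _ _ _ 0 _ 0) => t; rewrite /line /=; ring.
Qed.

Lemma d_zbar_sqnorm k z :
  d_zbar k (toC \o (fun z => pi * sqnorm z)) z = toC pi * z 0 k.
Proof.
have := inner_unit_vec 1 k z; rewrite scale1r => e1.
rewrite /d_zbar !dir_derivC_sqnorm e1 inner_unit_vec.
have -> : (2^-1 : C) = toC 2^-1.
  by apply: (mulfI (_ : (2 : C) != 0)); rewrite ?pnatr_eq0 // divff ?pnatr_eq0 //;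
     apply/eqP; rewrite eq_complex /=; apply/andP; split; apply/eqP; field.
case: (z 0 k) => x y; rewrite /toC /IC /ReC /ImC.
by apply/eqP; rewrite eq_complex /=; apply/andP; split; apply/eqP; field.
Qed.

Lemma dir_derivC_coord v (c : R) k z :
  dir_derivC v (fun z => toC c * z 0 k) z = toC c * v 0 k.
Proof.
transitivity (Complex (c * ReC (v 0 k)) (c * ImC (v 0 k)) : C).
  congr Complex.
    apply: (@dir_deriv_quadratic _ _ _ (c * ReC (z 0 k)) _ 0) => t.
    rewrite /line /= !mxE; case: (z 0 k) => ? ?; case: (v 0 k) => ? ?.
    by rewrite /ReC /=; ring.
  apply: (@dir_deriv_quadratic _ _ _ (c * ImC (z 0 k)) _ 0) => t.
  rewrite /line /= !mxE; case: (z 0 k) => ? ?; case: (v 0 k) => ? ?.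
  by rewrite /ImC /=; ring.
case: (v 0 k) => ? ?; apply/eqP; rewrite eq_complex /ReC /ImC /=.
by apply/andP; split; apply/eqP; ring.
Qed.

Lemma std_kahlerE z : std_kahler z = (IC / 2)%:M.
Proof.
apply/matrixP => j k; rewrite /std_kahler /ddc mxE.
rewrite (_ : d_zbar k _ = fun z => toC pi * z 0 k); last first.
  by apply/funext => w; exact: d_zbar_sqnorm.
rewrite /d_z !dir_derivC_coord !mxE eqxx /= [k == j]eq_sym.
have p0 : toC (pi : R) != 0 by rewrite eq_complex /= gt_eqF ?pi_gt0.
have i2 : (IC * IC : C) = -1.
  by apply/eqP; rewrite eq_complex /=; apply/andP; split; apply/eqP; ring.
have -> : toC (2 * pi : R) = 2 * toC pi.
  by apply/eqP; rewrite eq_complex /=; apply/andP; split; apply/eqP; ring.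
case: (j == k); last by rewrite ?(mulr0n, mulr0, subr0).
rewrite mulr1n !mulr1 [IC * (toC pi * IC)]mulrCA i2 mulrN1 opprK.
rewrite -mulr2n -(mulr_natl (toC pi) 2) mulKf ?pnatr_eq0 //.
by rewrite invfM -!mulrA mulVf // mulr1.
Qed.

End StdKahler.

Record lattice (R : realType) (m : nat) := Lattice {
  lattice_set : set 'rV[R]_m;
  latticeP : exists2 B : 'M[R]_m, B \in unitmx &
    lattice_set = [set v | exists k : 'rV[int]_m, v = map_mx intr k *m B]
}.

Lemma lattice0 (R : realType) m (L : lattice R m) : lattice_set L 0.
Proof.
by case: L => /= L [B _ ->]; exists 0; rewrite map_mx0 mul0mx.
Qed.

Lemma latticeN (R : realType) m (L : lattice R m) v :
  lattice_set L v -> lattice_set L (- v).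
Proof.
by case: L => /= L [B _ ->] [k ->]; exists (- k); rewrite map_mxN mulNmx.
Qed.

Lemma latticeD (R : realType) m (L : lattice R m) v w :
  lattice_set L v -> lattice_set L w -> lattice_set L (v + w).
Proof.
case: L => /= L [B _ ->] [k ->] [l ->].
by exists (k + l); rewrite map_mxD mulmxDl.
Qed.

Section Torus.
Context {R : realType} {n : nat} (L : lattice R (n + n)).
Local Notation C := (Cplx R).

(* points of R^{2n} are pairs (xi, x), with xi the first n coordinates *)
Definition lattice_C : set 'rV[C]_n :=
  [set z | lattice_set L (row_mx (map_mx ImC z) (map_mx ReC z))].

Definition torus_rel (z w : 'rV[C]_n) : bool := `[< lattice_C (z - w) >].

Lemma lattice_C0 : lattice_C 0.
Proof.
rewrite /lattice_C /= (_ : row_mx _ _ = 0); first exact: lattice0.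
by rewrite -row_mx0; congr row_mx; apply/matrixP => i j; rewrite !mxE.
Qed.

Lemma lattice_CN z : lattice_C z -> lattice_C (- z).
Proof.
rewrite /lattice_C /= => /latticeN; rewrite opp_row_mx.
congr (lattice_set L (row_mx _ _)); apply/matrixP => i j; rewrite !mxE.
  by case: (z i j).
by case: (z i j).
Qed.

Lemma lattice_CD z w : lattice_C z -> lattice_C w -> lattice_C (z + w).
Proof.
rewrite /lattice_C /= => Lz Lw; have := latticeD Lz Lw; rewrite add_row_mx.
congr (lattice_set L (row_mx _ _)); apply/matrixP => i j; rewrite !mxE.
  by case: (z i j) => ? ?; case: (w i j).
by case: (z i j) => ? ?; case: (w i j).
Qed.

Lemma torus_rel_refl : reflexive torus_rel.
Proof. by move=> z; apply/asboolP; rewrite subrr; exact: lattice_C0. Qed.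

Lemma torus_rel_sym : symmetric torus_rel.
Proof.
by move=> z w; apply/asboolP/asboolP => /lattice_CN; rewrite opprB.
Qed.

Lemma torus_rel_trans : transitive torus_rel.
Proof.
move=> w z t /asboolP zw /asboolP wt; apply/asboolP.
by have := lattice_CD zw wt; rewrite addrA subrK.
Qed.

Canonical torus_equiv :=
  EquivRel torus_rel torus_rel_refl torus_rel_sym torus_rel_trans.

Definition torus := quotient_topology {eq_quot torus_rel}.

HB.instance Definition _ := Topological.on torus.

Definition torus_proj (z : 'rV[C]_n) : torus := \pi_({eq_quot torus_rel})%qT z.
Definition torus_repr (p : torus) : 'rV[C]_n :=
  repr (p : {eq_quot torus_rel}).

Lemma torus_reprK : cancel torus_repr torus_proj.
Proof. exact: reprK. Qed.

Lemma torus_projP z w : torus_proj z = torus_proj w <-> lattice_C (z - w).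
Proof.
by split=> [/eqmodP/asboolP|zw] //; apply/eqmodP/asboolP.
Qed.

End Torus.

Section KahlerTorus.
Context {R : realType} {n : nat} {L : lattice R (n + n)}.
Local Notation C := (Cplx R).
Local Notation X := (torus L).
Local Notation unit_disk := (open_disk (0 : C) 1).

(* Forms on the torus are written in the global frame dz_j /\ d(conj z_k);
   [std_kahler] is translation invariant, see [torus_kahlerE]. *)
Definition torus_kahler (p : X) : 'M[C]_n := std_kahler (torus_repr p).

Lemma torus_kahlerE z :
  torus_kahler (torus_proj L z) = std_kahler z.
Proof. by rewrite /torus_kahler !std_kahlerE. Qed.

Definition local_potential (omega : X -> 'M[C]_n) (U : set X) (psi : X -> R) :
    Prop :=
  let pi_ := @torus_proj R n L in
  [/\ open U, smooth_on (pi_ @^-1` U) (psi \o pi_) &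
      forall z, U (pi_ z) -> ddc (psi \o pi_) z = omega (pi_ z)].

(* Holomorphic embedding of the unit disk: near each point f lifts to a
   holomorphic immersion into C^n (i.e. it is one in the charts given by the
   local inverses of the projection), and f is a homeomorphism onto its image. *)
Definition embedded_disk (f : C -> X) : Prop :=
  [/\ forall w, unit_disk w -> exists2 g : C -> 'rV[C]_n,
        \forall v \near w, torus_proj L (g v) = f v &
        \forall v \near w, derivable g v 1 /\ 'D_1 g v != 0,
      forall w w', unit_disk w -> unit_disk w' -> f w = f w' -> w = w' &
      forall O : set C, open O -> O `<=` unit_disk ->
        exists2 W : set X, open W & f @` O = W `&` f @` unit_disk].

Local Open Scope ereal_scope.

Definition PSH (omega : X -> 'M[C]_n) (phi : X -> \bar R) : Prop :=
  [/\ forall p, phi p < +oo,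
      forall p, usc_at phi p,
      exists p, phi p != -oo &
      forall (U : set X) (psi : X -> R) (f : C -> X),
        local_potential omega U psi -> embedded_disk f ->
        f @` unit_disk `<=` U ->
        subharmonic_on unit_disk (fun w => phi (f w) + (psi (f w))%:E)].

(* The Lelong number, in the chart [torus_proj (torus_repr p + z) |-> z]
   centred at p. *)
Definition lelong (phi : X -> \bar R) (p : X) : \bar R :=
  limf_einf (fun z : 'rV[C]_n =>
      phi (torus_proj L (torus_repr p + z)%R) / (ln (sqnorm z))%:E)
    (dnbhs (0%R : 'rV[C]_n)).

Definition psef_threshold (p : X) (omega : X -> 'M[C]_n) : \bar R :=
  ereal_sup [set gamma%:E | gamma in
    [set gamma : R | (0 <= gamma)%R /\
       exists2 phi : X -> \bar R, PSH omega phi & gamma%:E <= lelong phi p]].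

End KahlerTorus.

Definition uniqueness_set {R : realType} {n : nat} (S : set 'rV[Cplx R]_n) :
    Prop :=
  forall F : 'rV[Cplx R]_n -> Cplx R,
    (forall z, differentiable F z) ->
    (ereal_sup [set ((ReC (F z) ^+ 2 + ImC (F z) ^+ 2) *
                     expR (- (pi * sqnorm z)))%:E | z in setT] <= 1)%E ->
    (forall z, S z -> F z = 0) ->
    forall z, F z = 0.

(* Main.v *)
Require Import Defs.
From HB Require Import structures.
From mathcomp Require Import all_boot all_order all_algebra generic_quotient.
From mathcomp Require Import complex ring lra.
From mathcomp Require Import all_classical all_reals all_analysis measurable_realfun.

(** Suppose F <> 0 satisfies |F|^2 exp(-pi|z|^2) <= 1 and vanishes on the lattice.
    Then phi(z) = sup over lam of log |F(z + lam)|^2 - pi|z + lam|^2 is periodic, and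
    phi + pi|z|^2 = sup over lam of log |G_lam|^2, where
    G_lam(z) = F(z + lam) exp(- pi <z, lam> - pi|lam|^2 / 2) is holomorphic and
    |G_lam|^2 <= exp(pi|z|^2); hence phi is omega-plurisubharmonic on the torus.
    As G_lam(0) = 0, Schwarz's lemma bounds |G_lam(z)| by a multiple of |z|
    uniformly in lam, so the Lelong number of phi at 0 is at least 1.  The same
    bound makes the family G_lam equicontinuous, so no upper semicontinuous
    regularization of phi is needed.

    Subharmonicity of u = log E on an embedded disk is proved without Poisson
    kernels, and without lifting the disk globally.  The average of u over the N-th
    roots of unity, U(w) = sum_k u(a + zeta^k w) / N, satisfies the maximum
    principle because u is infinitesimally subharmonic; so U(0) is at most the
    maximum of U over |w| = r, and as N grows these sums tend, uniformly on that
    circle, to the circle mean of u. *)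

Set Implicit Arguments.
Unset Strict Implicit.
Unset Printing Implicit Defensive.

Import Order.TTheory GRing.Theory Num.Theory numFieldNormedType.Exports.

Local Open Scope classical_set_scope.
Local Open Scope ring_scope.

(** * The modulus and the topology of R[i] *)

(** The factor in [G_lam] is dictated by |z + lam|^2 = |z|^2 + 2 Re <z, lam> + |lam|^2: it is
    holomorphic in z, and its modulus absorbs everything except exp(pi|z|^2 / 2). A local potential
    psi differs from pi|z|^2 by a pluriharmonic function; writing e^psi as e^(pi|z|^2) times the
    squared modulus of a holomorphic function would call for a holomorphic primitive. The
    second-order Taylor polynomial of psi supplies such a factor at each point up to exp(o(|v -
    p|^2)). The maximum principle tolerates this error, because a preliminary perturbation by e|w|^2
    yields a gain of order e rho^2 on circles of radius rho. Averages over roots of unity are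
    handled as products, so that zeros of E meet no logarithm until the end, where E + eta and
    monotone convergence take care of the value -oo. The constant in Schwarz's lemma disappears in
    the limit of the Lelong quotient. The threshold is a supremum, so it suffices to reach every
    gamma < 1. *)

Section ComplexModulus.
Context {R : realType}.
Local Notation C := (Cplx R).
Implicit Types (z w : C) (x y : R).

(* The modulus as a real number: `|z| is an element of R[i]. *)
Definition cmod z : R := ReC `|z|.

Lemma toC_inj : injective (@toC R). Proof. by move=> x y []. Qed.
Lemma toCD x y : toC (x + y) = toC x + toC y. Proof. exact: (rmorphD (real_complex R)). Qed.
Lemma toCM x y : toC (x * y) = toC x * toC y. Proof. exact: (rmorphM (real_complex R)). Qed.
Lemma toC0 : toC 0 = 0 :> C. Proof. by []. Qed.
Lemma toC1 : toC 1 = 1 :> C. Proof. by []. Qed.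
Lemma toC_le x y : (toC x <= toC y) = (x <= y). Proof. exact: lecR. Qed.
Lemma toC_lt x y : (toC x < toC y) = (x < y). Proof. exact: ltcR. Qed.

Lemma Cext z w : ReC z = ReC w -> ImC z = ImC w -> z = w.
Proof. by case: z w => a b [c d]; rewrite /ReC /ImC /= => -> ->. Qed.

Lemma ReCD z w : ReC (z + w) = ReC z + ReC w. Proof. by case: z w => ? ? []. Qed.
Lemma ImCD z w : ImC (z + w) = ImC z + ImC w. Proof. by case: z w => ? ? []. Qed.
Lemma ReCN z : ReC (- z) = - ReC z. Proof. by case: z. Qed.
Lemma ImCN z : ImC (- z) = - ImC z. Proof. by case: z. Qed.
Lemma ReCB z w : ReC (z - w) = ReC z - ReC w. Proof. by rewrite ReCD ReCN. Qed.
Lemma ImCB z w : ImC (z - w) = ImC z - ImC w. Proof. by rewrite ImCD ImCN. Qed.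
Lemma ReCM z w : ReC (z * w) = ReC z * ReC w - ImC z * ImC w.
Proof. by case: z w => ? ? []. Qed.
Lemma ImCM z w : ImC (z * w) = ReC z * ImC w + ImC z * ReC w.
Proof. by case: z w => ? ? []. Qed.
Lemma ReC_toC x : ReC (toC x) = x. Proof. by []. Qed.
Lemma ImC_toC x : ImC (toC x) = 0. Proof. by []. Qed.
Lemma ReC_sum I (r : seq I) (f : I -> C) :
  ReC (\sum_(i <- r) f i) = \sum_(i <- r) ReC (f i).
Proof. by apply: (big_morph ReC) => [z w|//]; rewrite ReCD. Qed.

Lemma normC_cmod z : `|z| = toC (cmod z).
Proof. by rewrite /cmod normc_def. Qed.

Lemma cmodE z : cmod z = Num.sqrt (ReC z ^+ 2 + ImC z ^+ 2).
Proof. by rewrite /cmod normc_def. Qed.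

Lemma cmod_sqr z : cmod z ^+ 2 = ReC z ^+ 2 + ImC z ^+ 2.
Proof. by rewrite cmodE sqr_sqrtr // addr_ge0 ?sqr_ge0. Qed.

Lemma cmod_ge0 z : 0 <= cmod z. Proof. by rewrite cmodE sqrtr_ge0. Qed.
Lemma cmodM z w : cmod (z * w) = cmod z * cmod w.
Proof. by apply: toC_inj; rewrite toCM -!normC_cmod normrM. Qed.
Lemma cmodV z : cmod z^-1 = (cmod z)^-1.
Proof.
have [->|z0] := eqVneq z 0.
  by rewrite invr0 cmodE /= !expr0n /= addr0 sqrtr0 invr0.
have c0 : cmod z != 0.
  by apply: contra_neq z0 => cz; apply/normr0_eq0; rewrite normC_cmod cz.
apply: (mulfI c0); rewrite -cmodM !divff //; apply: toC_inj.
by rewrite -normC_cmod normr1.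
Qed.
Lemma cmodD z w : cmod (z + w) <= cmod z + cmod w.
Proof. by rewrite -toC_le toCD -!normC_cmod ler_normD. Qed.
Lemma cmodN z : cmod (- z) = cmod z.
Proof. by apply: toC_inj; rewrite -!normC_cmod normrN. Qed.
Lemma cmodBC z w : cmod (z - w) = cmod (w - z).
Proof. by rewrite -cmodN opprB. Qed.
Lemma cmod_eq0 z : (cmod z == 0) = (z == 0).
Proof.
rewrite -(normr_eq0 z) normC_cmod; apply/eqP/eqP => [->//|]; exact: toC_inj.
Qed.
Lemma cmod0 : cmod 0 = 0. Proof. by apply/eqP; rewrite cmod_eq0. Qed.
Lemma cmod_gt0 z : (0 < cmod z) = (z != 0).
Proof. by rewrite lt_def cmod_eq0 cmod_ge0 andbT. Qed.
Lemma cmod_toC x : cmod (toC x) = `|x|.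
Proof. by rewrite cmodE /= expr0n addr0 sqrtr_sqr. Qed.
Lemma cmod1 : cmod 1 = 1. Proof. by rewrite -toC1 cmod_toC normr1. Qed.
Lemma cmod_prod I (r : seq I) (f : I -> C) :
  cmod (\prod_(i <- r) f i) = \prod_(i <- r) cmod (f i).
Proof. by apply: (big_morph cmod) => [z w|]; rewrite ?cmodM ?cmod1. Qed.
Lemma cmodB_ge z w : cmod z - cmod w <= cmod (z - w).
Proof. by rewrite lerBlDr (le_trans _ (cmodD _ _)) // subrK. Qed.
Lemma cmod_dist z w : `|cmod z - cmod w| <= cmod (z - w).
Proof. by rewrite ler_norml lerNl opprB cmodB_ge cmodBC cmodB_ge. Qed.

Lemma ReC_le_cmod z : `|ReC z| <= cmod z.
Proof. by rewrite cmodE -sqrtr_sqr ler_wsqrtr // lerDl sqr_ge0. Qed.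
Lemma ImC_le_cmod z : `|ImC z| <= cmod z.
Proof. by rewrite cmodE -sqrtr_sqr ler_wsqrtr // lerDr sqr_ge0. Qed.
Lemma cmod_le_ReIm z : cmod z <= `|ReC z| + `|ImC z|.
Proof.
rewrite -(@ler_pXn2r _ 2%N) ?nnegrE ?cmod_ge0 ?addr_ge0 // cmod_sqr.
rewrite sqrrD !real_normK ?num_real // lerD2r lerDl mulrn_wge0 //.
Qed.

Lemma nearCP (P : C -> Prop) z :
  (\forall w \near z, P w) <-> exists2 d : R, 0 < d & forall w, cmod (w - z) < d -> P w.
Proof.
split=> [/nbhs_ballP[e /= e0 eP]|[d d0 dP]].
  have [e' ee'] : exists e', e = toC e'.
    by case: e e0 {eP} => a b; rewrite ltcE /= => /andP[/eqP -> _]; exists a.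
  exists e'; first by rewrite -toC_lt -ee'.
  move=> w wz; apply: eP; rewrite -ball_normE /= ee' normC_cmod toC_lt.
  by rewrite cmodBC.
apply/nbhs_ballP; exists (toC d) => /=; first by rewrite -toC0 toC_lt.
move=> w; rewrite -ball_normE /= normC_cmod toC_lt cmodBC; exact: dP.
Qed.

Lemma near_cmod z (d : R) : 0 < d -> \forall w \near z, cmod (w - z) < d.
Proof. by move=> d0; apply/nearCP; exists d. Qed.

Lemma cvgCP {T} {G : set_system T} {FG : Filter G} (f : T -> C) z :
  f @ G --> z <-> forall e : R, 0 < e -> \forall t \near G, cmod (f t - z) < e.
Proof.
split=> [fz e e0|H].
  apply: (fz (fun v => cmod (v - z) < e)); exact: near_cmod.
apply/cvg_ballP => e e0.
have [e' ee'] : exists e', e = toC e'.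
  by case: e e0 => a b; rewrite ltcE /= => /andP[/eqP -> _]; exists a.
have : 0 < e' by rewrite -toC_lt -ee'.
move=> /H; apply: filterS => t; rewrite -ball_normE /= normC_cmod ee' toC_lt.
by rewrite cmodBC.
Qed.

Lemma continuousCP (T : topologicalType) (f : T -> C) t :
  {for t, continuous f} <->
  forall e : R, 0 < e -> \forall s \near t, cmod (f s - f t) < e.
Proof. exact: cvgCP. Qed.

Lemma continuousC_deltaP (f : C -> C) z : {for z, continuous f} <->
  forall e : R, 0 < e -> exists2 d : R, 0 < d &
    forall w, cmod (w - z) < d -> cmod (f w - f z) < e.
Proof.
by rewrite continuousCP; split=> H e /H => [/nearCP|?]; last exact/nearCP.
Qed.

Lemma continuousCR_deltaP (f : C -> R) z : {for z, continuous f} <->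
  forall e : R, 0 < e -> exists2 d : R, 0 < d &
    forall w, cmod (w - z) < d -> `|f w - f z| < e.
Proof.
split=> [/cvgrPdist_lt H e /H /nearCP[d d0 D]|H].
  by exists d => // w /D; rewrite distrC.
have Fz : Filter (nbhs z) by exact: nbhs_filter.
apply: (iffRL (@cvgrPdist_lt _ _ _ (nbhs z) Fz f (f z))) => e /H[d d0 D].
by apply/nearCP; exists d => // w /D; rewrite distrC.
Qed.

Lemma continuous_cmod : continuous cmod.
Proof.
move=> z; apply/continuousCR_deltaP => e e0; exists e => // w.
exact/le_lt_trans/cmod_dist.
Qed.
Lemma continuous_ReC : continuous (@ReC R).
Proof.
move=> z; apply/continuousCR_deltaP => e e0; exists e => // w; rewrite -ReCB.
exact/le_lt_trans/ReC_le_cmod.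
Qed.
Lemma continuous_ImC : continuous (@ImC R).
Proof.
move=> z; apply/continuousCR_deltaP => e e0; exists e => // w; rewrite -ImCB.
exact/le_lt_trans/ImC_le_cmod.
Qed.

Lemma continuous_Complex (T : topologicalType) (f g : T -> R) t :
  {for t, continuous f} -> {for t, continuous g} ->
  {for t, continuous (fun s => Complex (f s) (g s) : C)}.
Proof.
move=> /cvgrPdist_lt cf /cvgrPdist_lt cg; apply/continuousCP => e e0.
have e2 : 0 < e / 2 by rewrite divr_gt0.
near=> s; rewrite (le_lt_trans (cmod_le_ReIm _)) //= (splitr e) ltrD //.
  by rewrite /ReC /= distrC; near: s; exact: cf.
by rewrite /ImC /= distrC; near: s; exact: cg.
Unshelve. all: by end_near. Qed.

Lemma differentiableC_approx (K : C -> C) z : differentiable K z ->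
  exists d : C, forall e : R, 0 < e -> exists2 r : R, 0 < r &
    forall h, cmod h < r -> cmod (K (z + h) - K z - d * h) <= e * cmod h.
Proof.
move=> /derivable1_diffP /cvg_ex[d /= Kd]; exists d => e e0.
have /nearCP[r r0 H] : \forall h \near (0 : C), h != 0 ->
    cmod (h^-1 *: (K (h%:A + z) - K z) - d) < e.
  by have /cvgCP/(_ e e0) := Kd.
exists r => // h hr; have [->|h0] := eqVneq h 0.
  by rewrite addr0 subrr mulr0 subrr cmod0 mulr0.
have := H h; rewrite subr0 => /(_ hr h0) /ltW.
rewrite [h%:A]mulr1 -[h^-1 *: _]/(h^-1 * _) => He.
have -> : K (z + h) - K z - d * h = (h^-1 * (K (h + z) - K z) - d) * h.
  by rewrite mulrBl mulrAC mulVf // mul1r [h + z]addrC.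
by rewrite cmodM ler_wpM2r ?cmod_ge0.
Qed.

Lemma differentiableC_of_approx (K : C -> C) z (d : C) :
  (forall e : R, 0 < e -> exists2 r : R, 0 < r &
    forall h, cmod h < r -> cmod (K (z + h) - K z - d * h) <= e * cmod h) ->
  differentiable K z.
Proof.
move=> H; apply/derivable1_diffP; apply/cvg_ex; exists d => /=.
apply/cvgCP => e e0.
suff : \forall h \near (0 : C), h != 0 ->
    cmod (h^-1 *: (K (h%:A + z) - K z) - d) < e by [].
have e2 : 0 < e / 2 by rewrite divr_gt0.
have [r r0 rP] := H _ e2; apply/nearCP; exists r => // h.
rewrite subr0 => hr h0; have := rP _ hr.
have hp : 0 < cmod h by rewrite cmod_gt0.
have -> : K (z + h) - K z - d * h = (h^-1 * (K (h + z) - K z) - d) * h.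
  by rewrite mulrBl mulrAC mulVf // mul1r [h + z]addrC.
rewrite [h%:A]mulr1 -[h^-1 *: _]/(h^-1 * _) cmodM ler_pM2r // => /le_lt_trans.
by apply; rewrite gtr_pMr // invf_lt1 // ltr1n.
Qed.

End ComplexModulus.

(** * Differentiation rules and the complex exponential *)

(* Pointwise forms over an abstract field: unification with the point-free
   forms of the library practically diverges over R[i]. *)
Section PointwiseRules.
Context {K : numFieldType} {V W : normedModType K}.

Lemma differentiable_add (f g : V -> W) x : differentiable f x -> differentiable g x ->
  differentiable (fun v => f v + g v) x.
Proof. exact: differentiableD. Qed.

Lemma differentiable_mul (f g : V -> K) x : differentiable f x -> differentiable g x ->
  differentiable (fun v => f v * g v) x.
Proof. exact: differentiableM. Qed.

Lemma differentiable_add_cst (f : V -> W) (c : W) x : differentiable f x ->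
  differentiable (fun v => f v + c) x.
Proof. by move=> df; apply: differentiable_add => //; exact: differentiable_cst. Qed.

Lemma differentiable_cst_add (f : V -> W) (c : W) x : differentiable f x ->
  differentiable (fun v => c + f v) x.
Proof. by move=> df; apply: differentiable_add => //; exact: differentiable_cst. Qed.

Lemma differentiable_cst_mul (f : V -> K) (c : K) x : differentiable f x ->
  differentiable (fun v => c * f v) x.
Proof. by move=> df; apply: differentiable_mul => //; exact: differentiable_cst. Qed.

Lemma differentiable_fsum I (s : seq I) (f : I -> V -> W) x :
  (forall i, differentiable (f i) x) ->
  differentiable (fun w => \sum_(i <- s) f i w) x.
Proof.
move=> df; elim: s => [|i s IH].
  under eq_fun do rewrite big_nil; exact: differentiable_cst.
by under eq_fun do rewrite big_cons; apply: differentiable_add => //; exact: df.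
Qed.

Lemma differentiable_prod I (s : seq I) (f : I -> V -> K) x :
  (forall i, differentiable (f i) x) ->
  differentiable (fun w => \prod_(i <- s) f i w) x.
Proof.
move=> df; elim: s => [|i s IH].
  under eq_fun do rewrite big_nil; exact: differentiable_cst.
by under eq_fun do rewrite big_cons; apply: differentiable_mul => //; exact: df.
Qed.

End PointwiseRules.

Section PointwiseRulesField.
Context {K : numFieldType}.

Lemma differentiable_affine (a b x : K) : differentiable (fun v : K => a + b * v) x.
Proof.
apply: differentiable_cst_add; apply: differentiable_cst_mul.
exact: ex_diff.
Qed.

Lemma differentiable_mul_shift (a b x : K) : differentiable (fun v : K => a * (v - b)) x.
Proof.
apply: differentiable_cst_mul; apply: differentiable_add_cst.
exact: ex_diff.
Qed.

Lemma differentiable_fcomp (U V W : normedModType K) (f : U -> V) (g : V -> W) x :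
  differentiable f x -> differentiable g (f x) -> differentiable (fun v => g (f v)) x.
Proof. exact: differentiable_comp. Qed.

Lemma differentiable_quotient (f : K -> K) x : x != 0 -> differentiable f x ->
  differentiable (fun v => f v / v) x.
Proof.
move=> x0 df; apply: differentiable_mul => //.
exact: differentiable_Rinv.
Qed.

Lemma continuous_fprod (T : topologicalType) I (s : seq I) (f : I -> T -> K) p :
  (forall i, {for p, continuous (f i)}) ->
  {for p, continuous (fun w => \prod_(i <- s) f i w)}.
Proof.
move=> df; elim: s => [|i s IH].
  have -> : (fun w => \prod_(i <- [::]) f i w) = fun=> 1.
    by apply/funext => w; rewrite big_nil.
  exact: cst_continuous.
have -> : (fun w => \prod_(j <- i :: s) f j w) = fun w => f i w * \prod_(j <- s) f j w.
  by apply/funext => w; rewrite big_cons.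
by apply: continuousM; [exact: df|exact: IH].
Qed.

Lemma continuous_mul (T : topologicalType) (f g : T -> K) x :
  {for x, continuous f} -> {for x, continuous g} ->
  {for x, continuous (fun v => f v * g v)}.
Proof. exact: continuousM. Qed.

Lemma continuous_add (T : topologicalType) (f g : T -> K) x :
  {for x, continuous f} -> {for x, continuous g} ->
  {for x, continuous (fun v => f v + g v)}.
Proof. exact: continuousD. Qed.

Lemma continuous_fsum (T : topologicalType) I (s : seq I) (f : I -> T -> K) p :
  (forall i, {for p, continuous (f i)}) ->
  {for p, continuous (fun w => \sum_(i <- s) f i w)}.
Proof.
move=> df; elim: s => [|i s IH].
  have -> : (fun w => \sum_(i <- [::]) f i w) = fun=> 0.
    by apply/funext => w; rewrite big_nil.
  exact: cst_continuous.
have -> : (fun w => \sum_(j <- i :: s) f j w) = fun w => f i w + \sum_(j <- s) f j w.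
  by apply/funext => w; rewrite big_cons.
by apply: continuousD; [exact: df|exact: IH].
Qed.

Lemma continuous_cst_mul (T : topologicalType) (f : T -> K) (c : K) x :
  {for x, continuous f} -> {for x, continuous (fun v => c * f v)}.
Proof. by move=> cf; apply: continuous_mul => //; exact: cst_continuous. Qed.

Lemma continuous_fcomp (T T' T'' : topologicalType) (f : T -> T') (g : T' -> T'') x :
  {for x, continuous f} -> {for f x, continuous g} ->
  {for x, continuous (fun v => g (f v))}.
Proof. exact: continuous_comp. Qed.

Lemma eq_off_differentiable (f g : K -> K) x : {near x, f =1 g} ->
  differentiable f x -> differentiable g x.
Proof.
move=> fg /derivable1_diffP df; apply/derivable1_diffP; move: df.
by apply: near_eq_derivable fg; rewrite oner_eq0.
Qed.

End PointwiseRulesField.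

Section ComplexExponential.
Context {R : realType}.
Local Notation C := (Cplx R).
Implicit Types (z w : C) (x y : R).

Lemma is_derive_approx (f : R -> R) x d : is_derive x 1 f d ->
  forall e : R, 0 < e -> exists2 r : R, 0 < r &
    forall h, `|h| < r -> `|f (x + h) - f x - d * h| <= e * `|h|.
Proof.
move=> fd e e0.
have /cvgrPdist_lt/(_ _ e0)/nbhs_ballP[r /= r0 H] :
    (fun h => h^-1 *: (f (h%:A + x) - f x)) @ 0^' --> d.
  rewrite -(@derive_val _ _ _ x 1 f d fd).
  by have := @ex_derive _ _ _ x 1 f d fd => /cvgP; apply.
exists r => // h hr; have [->|h0] := eqVneq h 0.
  by rewrite addr0 subrr mulr0 subrr normr0 mulr0.
have := H h; rewrite /ball /= sub0r normrN => /(_ hr h0) /ltW.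
rewrite [h%:A]mulr1 -[h^-1 *: _]/(h^-1 * _) => He.
have -> : f (x + h) - f x - d * h = (h^-1 * (f (h + x) - f x) - d) * h.
  by rewrite mulrBl mulrAC mulVf // mul1r [h + x]addrC.
by rewrite normrM ler_wpM2r // distrC.
Qed.

Definition cexp z : C := Complex (expR (ReC z) * cos (ImC z)) (expR (ReC z) * sin (ImC z)).

Lemma cexpD z w : cexp (z + w) = cexp z * cexp w.
Proof.
apply: Cext; rewrite ?ReCM ?ImCM /cexp {1}/ReC {1}/ImC /= /ReC /ImC /= -/(ReC _) -/(ImC _).
  by rewrite ReCD ImCD expRD cosD; ring.
by rewrite ReCD ImCD expRD sinD; ring.
Qed.

Lemma cexp0 : cexp 0 = 1.
Proof. by apply: Cext; rewrite /ReC /ImC /= expR0 ?cos0 ?sin0 ?mulr1 ?mulr0. Qed.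

Lemma cmod_cexp z : cmod (cexp z) = expR (ReC z).
Proof.
rewrite cmodE {1}/ReC {1}/ImC /= !exprMn -mulrDr cos2Dsin2 mulr1 sqrtr_sqr.
by rewrite ger0_norm // expR_ge0.
Qed.

(** The functional equation [cexpD] moves the question to 0, where the linear approximations of exp,
    sin and cos are combined. *)
Lemma differentiable_cexp z : differentiable cexp z.
Proof.
apply: (@differentiableC_of_approx _ _ _ (cexp z)) => e e0.
set M := expR (ReC z).
have M0 : 0 < M by exact: expR_gt0.
(* The 9 is 3 + 1 + 3 + 2, one summand for each of four error terms, bounded with e^x <= 3, |e^x -
   1| <= 2|h| and |Im h| < c. The minimum with 1 serves the first two of these bounds. *)
pose c := e / (M * 9); have c0 : 0 < c by rewrite divr_gt0 // mulr_gt0.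
have c1 : 0 < Num.min c 1 by rewrite lt_min c0 ltr01.
have [r1 r10 E] := is_derive_approx (is_derive_expR 0) c1.
have [r2 r20 S] := is_derive_approx (is_derive_sin 0) c0.
have [r3 r30 T] := is_derive_approx (is_derive_cos 0) c0.
pose r := Num.min (Num.min r1 r2) (Num.min r3 (Num.min c 1)).
exists r; first by rewrite !lt_min r10 r20 r30 c0 ltr01.
move=> h; rewrite !lt_min => /andP[/andP[h1 h2] /and3P[h3 hc h4]].
have -> : cexp (z + h) - cexp z - cexp z * h = cexp z * (cexp h - 1 - h).
  by rewrite cexpD; ring.
rewrite cmodM cmod_cexp -/M.
suff H : cmod (cexp h - 1 - h) <= c * 9 * cmod h.
  have cM : M * (c * 9) = e by rewrite /c; field; rewrite gt_eqF.
  by apply: le_trans (ler_wpM2l (ltW M0) H) _; rewrite mulrA cM.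
rewrite (le_trans (cmod_le_ReIm _)) // !(ReCB, ImCB).
have -> : ReC (cexp h) = expR (ReC h) * cos (ImC h) by [].
have -> : ImC (cexp h) = expR (ReC h) * sin (ImC h) by [].
have hx := ReC_le_cmod h; have hy := ImC_le_cmod h.
set x := ReC h in hx *; set y := ImC h in hy *; set H := cmod h in h1 h2 h3 hc h4 hx hy *.
have H0 : 0 <= H by exact: cmod_ge0.
have := E x (le_lt_trans hx h1); rewrite add0r expR0 mul1r => Ex.
have := S y (le_lt_trans hy h2); rewrite add0r sin0 cos0 mul1r subr0 => Sy.
have := T y (le_lt_trans hy h3); rewrite add0r sin0 cos0 oppr0 mul0r subr0 => Ty.
have [m0 mc m1] : [/\ 0 <= Num.min c 1, Num.min c 1 <= c & Num.min c 1 <= 1].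
  by split; [exact: ltW|rewrite ge_min lexx|rewrite ge_min lexx orbT].
have Ex1 : `|expR x - 1 - x| <= c * H.
  by rewrite (le_trans Ex) // ler_pM.
have Ex2 : `|expR x - 1| <= 2 * H.
  rewrite -[expR x - 1](subrK x) (le_trans (ler_normD _ _)) //.
  have : `|expR x - 1 - x| <= H.
    by rewrite (le_trans Ex) // -[leRHS]mul1r ler_pM.
  by move: hx; lra.
have Ex3 : `|expR x| <= 3.
  rewrite -[expR x](subrK 1) (le_trans (ler_normD _ _)) // normr1.
  by move: Ex2 h4; lra.
have Sy1 : `|sin y - y| <= c * H by rewrite (le_trans Sy) // ler_wpM2l // ltW.
have Ty1 : `|cos y - 1| <= c * H by rewrite (le_trans Ty) // ler_wpM2l // ltW.
have -> : expR x * cos y - ReC 1 - x = expR x * (cos y - 1) + (expR x - 1 - x).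
  by rewrite /ReC /=; ring.
rewrite [X in _ + `|X|](_ : _ = expR x * (sin y - y) + (expR x - 1) * y); last first.
  by rewrite /ImC /=; ring.
have A1 : `|expR x * (cos y - 1)| <= 3 * (c * H) by rewrite normrM ler_pM.
have A2 : `|expR x * (sin y - y)| <= 3 * (c * H) by rewrite normrM ler_pM.
have A3 : `|(expR x - 1) * y| <= 2 * H * c.
  by rewrite normrM ler_pM // (le_trans hy) // ltW.
have := ler_normD (expR x * (cos y - 1)) (expR x - 1 - x).
have := ler_normD (expR x * (sin y - y)) ((expR x - 1) * y).
move: A1 A2 A3 Ex1; nra.
Qed.

End ComplexExponential.

(** * Goursat's theorem on rectangles *)

Section Segment.
Context {R : realType}.
Implicit Types (f g : R -> R) (a b c : R).

Definition Int a b f : R := \int[lebesgue_measure]_(x in `[a, b]) f x.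

Definition cont_seg a b f := forall x, a <= x <= b -> {for x, continuous f}.

Lemma cont_seg_sub a b c d f : a <= c -> d <= b -> cont_seg a b f -> cont_seg c d f.
Proof.
move=> ac db H x /andP[cx xd]; apply: H.
by rewrite (le_trans ac cx) (le_trans xd db).
Qed.

Lemma cont_segB a b f g : cont_seg a b f -> cont_seg a b g ->
  cont_seg a b (fun x => f x - g x).
Proof. by move=> cf cg x xab; apply: continuousB; [exact: cf|exact: cg]. Qed.

Lemma Int_integrable a b f : cont_seg a b f ->
  (@lebesgue_measure R).-integrable `[a, b] (EFin \o f).
Proof.
move=> cf; apply: continuous_compact_integrable; first exact: segment_compact.
apply: continuous_in_subspaceT => x; rewrite inE /= in_itv /= => xab.
exact: cf.
Qed.

Lemma IntB a b f g : cont_seg a b f -> cont_seg a b g ->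
  Int a b (fun x => f x - g x) = Int a b f - Int a b g.
Proof. by move=> cf cg; rewrite /Int RintegralB //; exact: Int_integrable. Qed.

Lemma Int_cat a b c f : a <= b -> b <= c -> cont_seg a c f ->
  Int a c f = Int a b f + Int b c f.
Proof.
move=> ab bc cf; have cbc : cont_seg b c f by exact: cont_seg_sub cf.
apply/eqP; rewrite addrC -subr_eq; apply/eqP.
rewrite /Int Rintegral_itvB ?bnd_simp //; last exact: Int_integrable.
apply: Rintegral_itv_obnd_cbnd.
apply: integrableS (Int_integrable cbc) => //.
by apply: subset_itvr; rewrite bnd_simp.
Qed.

Lemma Int_cst a b c : a <= b -> Int a b (fun=> c) = c * (b - a).
Proof.
move=> ab; rewrite /Int Rintegral_cst // [X in fine X](lebesgue_measure_itv `[a, b]) /= lte_fin.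
case: ltP => [//|ba]; have -> : a = b by apply/eqP; rewrite eq_le ab ba.
by rewrite subrr.
Qed.

Lemma cont_seg_cst a b c : cont_seg a b (fun=> c).
Proof. by move=> x _; exact: cst_continuous. Qed.

Lemma le_Int a b f g : cont_seg a b f -> cont_seg a b g ->
  (forall x, a <= x <= b -> f x <= g x) -> Int a b f <= Int a b g.
Proof.
move=> cf cg fg; apply: le_Rintegral => //; exact: Int_integrable.
Qed.

Lemma Int_dist a b c e f : a <= b -> cont_seg a b f ->
  (forall x, a <= x <= b -> `|f x - c| <= e) ->
  `|Int a b f - c * (b - a)| <= e * (b - a).
Proof.
move=> ab cf H; rewrite ler_distl -mulrBl -mulrDl -!Int_cst //.
have K := @cont_seg_cst a b.
by apply/andP; split; apply: le_Int => // x /H; rewrite ler_distl => /andP[].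
Qed.

End Segment.

Section Goursat.
Context {R : realType}.
Implicit Types (P Q : R -> R -> R) (x y l m : R).

(* P + iQ is complex differentiable at x + iy with derivative A + iB *)
Definition holo_at P Q x y := exists A B : R, forall e : R, 0 < e ->
  exists2 r : R, 0 < r & forall h k, `|h| < r -> `|k| < r ->
    `|P (x + h) (y + k) - P x y - (A * h - B * k)| <= e * (`|h| + `|k|) /\
    `|Q (x + h) (y + k) - Q x y - (B * h + A * k)| <= e * (`|h| + `|k|).

Definition holo_box P Q x y l m :=
  forall u v, x <= u <= x + l -> y <= v <= y + m -> holo_at P Q u v.

(** This is the imaginary part of the counterclockwise integral of (P + iQ) dz: the part in which P
    sits on the vertical sides, so that its vanishing compares the integrals of P over those two
    sides. *)
Definition circulation P Q x y l m :=
  Int x (x + l) (fun u => Q u y - Q u (y + m)) +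
  Int y (y + m) (fun v => P (x + l) v - P x v).

Lemma continuous_of_lin (f : R -> R) (x d : R) :
  (exists2 r : R, 0 < r & forall h, `|h| < r -> `|f (x + h) - f x - d * h| <= `|h|) ->
  {for x, continuous f}.
Proof.
move=> [r r0 H].
apply: (iffRL (@cvgrPdist_lt _ _ _ (nbhs x) _ f (f x))) => e e0.
pose D := `|d| + 1; have D0 : 0 < D by rewrite ltr_wpDl.
have s0 : 0 < Num.min r (e / D) by rewrite lt_min r0 divr_gt0.
apply/nbhs_ballP; exists (Num.min r (e / D)) => //= u; rewrite /ball /=.
rewrite lt_min distrC => /andP[ur ue]; rewrite distrC.
have := H _ ur; rewrite [x + _]addrC subrK => L.
rewrite -[f u - f x](subrK (d * (u - x))) (le_lt_trans (ler_normD _ _)) //.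
rewrite (le_lt_trans (lerD L (lexx _))) // normrM.
by move: ue; rewrite ltr_pdivlMr // /D; nra.
Qed.

Lemma holo_at_cont P Q x y : holo_at P Q x y ->
  [/\ {for x, continuous (P ^~ y)}, {for x, continuous (Q ^~ y)},
      {for y, continuous (P x)} & {for y, continuous (Q x)}].
Proof.
move=> [A [B /(_ _ ltr01)[r r0 H]]].
split; [apply: (@continuous_of_lin _ _ A)|apply: (@continuous_of_lin _ _ B)|
  apply: (@continuous_of_lin _ _ (- B))|apply: (@continuous_of_lin _ _ A)];
  exists r => // h hr.
- have := H h 0 hr; rewrite normr0 => /(_ r0)[+ _].
  by rewrite addr0 mulr0 subr0 addr0 mul1r.
- have := H h 0 hr; rewrite normr0 => /(_ r0)[_].
  by rewrite addr0 mulr0 !addr0 mul1r.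
- have := H 0 h; rewrite normr0 => /(_ r0 hr)[+ _].
  by rewrite addr0 mulr0 !add0r mul1r mulNr.
- have := H 0 h; rewrite normr0 => /(_ r0 hr)[_].
  by rewrite addr0 mulr0 !add0r mul1r.
Qed.

Lemma holo_box_cont P Q x y l m : 0 <= l -> 0 <= m -> holo_box P Q x y l m ->
  (forall v, y <= v <= y + m -> cont_seg x (x + l) (P ^~ v) /\ cont_seg x (x + l) (Q ^~ v)) /\
  (forall u, x <= u <= x + l -> cont_seg y (y + m) (P u) /\ cont_seg y (y + m) (Q u)).
Proof.
move=> l0 m0 H; split=> [v vy|u ux]; split=> t ht.
- by case: (holo_at_cont (H _ _ ht vy)).
- by case: (holo_at_cont (H _ _ ht vy)).
- by case: (holo_at_cont (H _ _ ux ht)).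
- by case: (holo_at_cont (H _ _ ux ht)).
Qed.

Lemma circulation_h P Q x y l l' m : 0 <= l -> 0 <= l' -> 0 <= m ->
  holo_box P Q x y (l + l') m ->
  circulation P Q x y (l + l') m =
  circulation P Q x y l m + circulation P Q (x + l) y l' m.
Proof.
move=> l0 l'0 m0 H.
have [H1 H2] := holo_box_cont (addr_ge0 l0 l'0) m0 H.
have [yb yt] : y <= y <= y + m /\ y <= y + m <= y + m by rewrite !lexx lerDl m0.
have [[_ c1] [_ c2]] := (H1 _ yb, H1 _ yt).
have x1 : x <= x <= x + (l + l') by rewrite lexx lerDl addr_ge0.
have x2 : x <= x + l <= x + (l + l') by rewrite addrA !lerDl l0 l'0.
have x3 : x <= x + (l + l') <= x + (l + l') by rewrite lexx lerDl addr_ge0.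
have [[d1 _] [d2 _] [d3 _]] := And3 (H2 _ x1) (H2 _ x2) (H2 _ x3).
rewrite /circulation !addrA; rewrite !addrA in c1 c2 d3.
have -> := Int_cat (_ : x <= x + l) (_ : x + l <= x + l + l') (cont_segB c1 c2); rewrite ?lerDl //.
by rewrite (IntB d3 d1) (IntB d2 d1) (IntB d3 d2); ring.
Qed.

Lemma circulation_v P Q x y l m m' : 0 <= l -> 0 <= m -> 0 <= m' ->
  holo_box P Q x y l (m + m') ->
  circulation P Q x y l (m + m') =
  circulation P Q x y l m + circulation P Q x (y + m) l m'.
Proof.
move=> l0 m0 m'0 H.
have [H1 H2] := holo_box_cont l0 (addr_ge0 m0 m'0) H.
have [xb xt] : x <= x <= x + l /\ x <= x + l <= x + l by rewrite !lexx lerDl l0.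
have [[c1 _] [c2 _]] := (H2 _ xb, H2 _ xt).
have y1 : y <= y <= y + (m + m') by rewrite lexx lerDl addr_ge0.
have y2 : y <= y + m <= y + (m + m') by rewrite addrA !lerDl m0 m'0.
have y3 : y <= y + (m + m') <= y + (m + m') by rewrite lexx lerDl addr_ge0.
have [[_ d1] [_ d2] [_ d3]] := And3 (H1 _ y1) (H1 _ y2) (H1 _ y3).
rewrite /circulation !addrA; rewrite !addrA in c1 c2 d3.
have -> := Int_cat (_ : y <= y + m) (_ : y + m <= y + m + m') (cont_segB c2 c1); rewrite ?lerDl //.
by rewrite (IntB d1 d3) (IntB d1 d2) (IntB d2 d3); ring.
Qed.

Lemma holo_box_sub P Q x y l m x' y' l' m' :
  x <= x' -> x' + l' <= x + l -> y <= y' -> y' + m' <= y + m ->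
  holo_box P Q x y l m -> holo_box P Q x' y' l' m'.
Proof.
move=> h1 h2 h3 h4 H u v /andP[u1 u2] /andP[v1 v2]; apply: H.
  by rewrite (le_trans h1 u1) (le_trans u2 h2).
by rewrite (le_trans h3 v1) (le_trans v2 h4).
Qed.

(** The circulations of the four quarters add up to the whole, so one of them carries at least a
    quarter of its absolute value. *)
Lemma circulation_quarter P Q x y l m : 0 <= l -> 0 <= m ->
  holo_box P Q x y (l + l) (m + m) ->
  exists2 s : R * R,
    [/\ x <= s.1, s.1 + l <= x + (l + l), y <= s.2 & s.2 + m <= y + (m + m)] &
    `|circulation P Q x y (l + l) (m + m)| <= 4 * `|circulation P Q s.1 s.2 l m|.
Proof.
move=> l0 m0 H.
have Hl : holo_box P Q x y l (m + m) by apply: holo_box_sub H; rewrite ?lexx // lerD2l lerDl.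
have Hr : holo_box P Q (x + l) y l (m + m).
  by apply: holo_box_sub H; rewrite ?addrA ?lexx // lerDl.
rewrite circulation_h // ?addr_ge0 // !circulation_v //.
set a := circulation P Q x y l m; set b := circulation P Q x (y + m) l m.
set c := circulation P Q (x + l) y l m; set d := circulation P Q (x + l) (y + m) l m.
have T : `|a + b + (c + d)| <= `|a| + `|b| + (`|c| + `|d|).
  by rewrite (le_trans (ler_normD _ _)) // lerD // ler_normD.
have [La|La] := leP `|a + b + (c + d)| (4 * `|a|).
  by exists (x, y) => //=; split; lra.
have [Lb|Lb] := leP `|a + b + (c + d)| (4 * `|b|).
  by exists (x, y + m) => //=; split; lra.
have [Lc|Lc] := leP `|a + b + (c + d)| (4 * `|c|).
  by exists (x + l, y) => //=; split; lra.
have [Ld|Ld] := leP `|a + b + (c + d)| (4 * `|d|).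
  by exists (x + l, y + m) => //=; split; lra.
by exfalso; lra.
Qed.

(** For the linear part of P + iQ the horizontal sides contribute -A m l and the vertical ones A l
    m, which cancel. The remainders differ by at most 2e(l + m) between opposite sides, and
    integrating over lengths l and m gives 2e(l + m)^2. *)
Lemma circulation_local P Q x y : holo_at P Q x y ->
  forall e : R, 0 < e -> exists2 r : R, 0 < r & forall x0 y0 l m,
    0 <= l -> 0 <= m -> l < r -> m < r ->
    x0 <= x <= x0 + l -> y0 <= y <= y0 + m -> holo_box P Q x0 y0 l m ->
    `|circulation P Q x0 y0 l m| <= 2 * e * (l + m) ^+ 2.
Proof.
move=> [A [B H]] e e0; have [r r0 {}H] := H _ e0; exists r => // x0 y0 l m l0 m0 lr mr.
move=> /andP[xa xb] /andP[ya yb] Hb.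
have [H1 H2] := holo_box_cont l0 m0 Hb.
have [y1 y2] : y0 <= y0 <= y0 + m /\ y0 <= y0 + m <= y0 + m by rewrite !lexx lerDl m0.
have [x1 x2] : x0 <= x0 <= x0 + l /\ x0 <= x0 + l <= x0 + l by rewrite !lexx lerDl l0.
have loc u v : x0 <= u <= x0 + l -> y0 <= v <= y0 + m ->
   `|P u v - P x y - (A * (u - x) - B * (v - y))| <= e * (l + m) /\
   `|Q u v - Q x y - (B * (u - x) + A * (v - y))| <= e * (l + m).
  move=> /andP[ua ub] /andP[va vb].
  have hu : `|u - x| <= l by rewrite ler_norml; lra.
  have hv : `|v - y| <= m by rewrite ler_norml; lra.
  have := H _ _ (le_lt_trans hu lr) (le_lt_trans hv mr).
  rewrite ![_ + (_ - _)]addrC !subrK => -[T1 T2].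
  have L : e * (`|u - x| + `|v - y|) <= e * (l + m) by rewrite ler_wpM2l ?lerD // ltW.
  by rewrite !(le_trans _ L).
have b1 : `|Int x0 (x0 + l) (fun u => Q u y0 - Q u (y0 + m)) - (- A * m) * (x0 + l - x0)|
    <= (2 * e * (l + m)) * (x0 + l - x0).
  apply: Int_dist; first by rewrite lerDl.
    by apply: cont_segB; [case: (H1 _ y1)|case: (H1 _ y2)].
  move=> u ux; have [_ +] := loc u _ ux y1; have [_ +] := loc u _ ux y2.
  by rewrite !ler_norml; lra.
have b2 : `|Int y0 (y0 + m) (fun v => P (x0 + l) v - P x0 v) - (A * l) * (y0 + m - y0)|
    <= (2 * e * (l + m)) * (y0 + m - y0).
  apply: Int_dist; first by rewrite lerDl.
    by apply: cont_segB; [case: (H2 _ x2)|case: (H2 _ x1)].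
  move=> v vy; have [+ _] := loc _ v x1 vy; have [+ _] := loc _ v x2 vy.
  by rewrite !ler_norml; lra.
have xl : x0 + l - x0 = l by ring.
have ym : y0 + m - y0 = m by ring.
rewrite {}xl in b1; rewrite {}ym in b2; rewrite /circulation; move: b1 b2.
set I1 := Int _ _ _; set I2 := Int _ _ _ => b1 b2.
have -> : I1 + I2 = (I1 - - A * m * l) + (I2 - A * l * m) by ring.
rewrite (le_trans (ler_normD _ _)) // (le_trans (lerD b1 b2)) // le_eqVlt.
by apply/orP; left; apply/eqP; ring.
Qed.

Theorem goursat P Q x y l m : 0 <= l -> 0 <= m -> holo_box P Q x y l m ->
  circulation P Q x y l m = 0.
Proof.
move=> l0 m0 Hb.
pose L n := l / 2 ^+ n; pose M n := m / 2 ^+ n.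
have L0 n : 0 <= L n by rewrite divr_ge0.
have M0 n : 0 <= M n by rewrite divr_ge0.
have half (c : R) n : c / 2 ^+ n = c / 2 ^+ n.+1 + c / 2 ^+ n.+1.
  rewrite exprS invfM mulrA -mulrDl; congr (_ * _); exact: splitr.
have LS n : L n = L n.+1 + L n.+1 by exact: half.
have MS n : M n = M n.+1 + M n.+1 by exact: half.
(* Bisection as a choice function on (level, corner). The default (0, 0) for boxes without
   differentiability is never met, since [sP] keeps every selected box inside the initial one. *)
have : forall t : nat * (R * R), exists s : R * R,
    holo_box P Q t.2.1 t.2.2 (L t.1) (M t.1) ->
    [/\ t.2.1 <= s.1, s.1 + L t.1.+1 <= t.2.1 + L t.1,
        t.2.2 <= s.2 & s.2 + M t.1.+1 <= t.2.2 + M t.1] /\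
    `|circulation P Q t.2.1 t.2.2 (L t.1) (M t.1)| <=
      4 * `|circulation P Q s.1 s.2 (L t.1.+1) (M t.1.+1)|.
  move=> [n [a b]] /=; have [H|H] := pselect (holo_box P Q a b (L n) (M n)); last by exists (0, 0).
  have := H; rewrite LS MS => /(circulation_quarter (L0 _) (M0 _))[s s1 s2].
  by exists s.
move=> /choice[f fP].
pose s := fix s n := if n is n'.+1 then f (n', s n') else (x, y).
have sP n : holo_box P Q (s n).1 (s n).2 (L n) (M n) /\
    `|circulation P Q x y l m| <= 4 ^+ n * `|circulation P Q (s n).1 (s n).2 (L n) (M n)|.
  elim: n => [|n [IH1 IH2]]; first by rewrite /= /L /M expr0 !divr1 mul1r.
  have [[h1 h2 h3 h4] h5] := fP (n, s n) IH1; split.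
    exact: holo_box_sub IH1.
  apply: le_trans IH2 _; rewrite [in leRHS]exprSr -mulrA ler_wpM2l //.
have mono n : [/\ (s n).1 <= (s n.+1).1, (s n.+1).1 + L n.+1 <= (s n).1 + L n,
     (s n).2 <= (s n.+1).2 & (s n.+1).2 + M n.+1 <= (s n).2 + M n].
  by have [] := fP (n, s n) (sP n).1.
(* Nested intervals: the supremum of the left ends lies in all of them. *)
have nest (g : nat -> R) (w : nat -> R) : (forall n, 0 <= w n) ->
    (forall n, g n <= g n.+1) -> (forall n, g n.+1 + w n.+1 <= g n + w n) ->
    exists c, forall n, g n <= c <= g n + w n.
  move=> w0 g1 g2.
  have up n k : g n <= g (n + k)%N.
    by elim: k => [|k IH]; rewrite ?addn0 // addnS (le_trans IH).
  have dn n k : g (n + k)%N + w (n + k)%N <= g n + w n.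
    by elim: k => [|k IH]; rewrite ?addn0 // addnS (le_trans _ IH).
  have ub n k : g k <= g n + w n.
    have [/subnKC <-|/ltnW /subnKC <-] := leqP n k.
      by rewrite (le_trans _ (dn n (k - n)%N)) // lerDl.
    by rewrite (le_trans (up k (n - k)%N)) // lerDl.
  exists (sup (range g)) => n; apply/andP; split.
    apply: ub_le_sup; last by exists n.
    by exists (g 0%N + w 0%N) => _ [k _ <-].
  apply: ge_sup; first by exists (g 0%N), 0%N.
  by move=> _ [k _ <-].
have [a aP] := nest (fun n => (s n).1) L L0 (fun n => let: And4 h _ _ _ := mono n in h)
  (fun n => let: And4 _ h _ _ := mono n in h).
have [b bP] := nest (fun n => (s n).2) M M0 (fun n => let: And4 _ _ h _ := mono n in h)
  (fun n => let: And4 _ _ _ h := mono n in h).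
have hab : holo_at P Q a b.
  apply: Hb; first by have := aP 0%N; rewrite /L expr0 divr1.
  by have := bP 0%N; rewrite /M expr0 divr1.
(* The factor 4^n lost in n bisections is exactly compensated by the square of (l + m) / 2^n. *)
have small e : 0 < e -> `|circulation P Q x y l m| <= 2 * e * (l + m) ^+ 2.
  move=> e0; have [r r0 rP] := circulation_local hab e0.
  pose n := Num.bound ((l + m) / r).
  have big : (l + m) / 2 ^+ n < r.
    rewrite ltr_pdivrMr ?exprn_gt0 // -ltr_pdivrMl // mulrC.
    rewrite (lt_le_trans (archi_boundP _)) ?divr_ge0 ?addr_ge0 ?(ltW r0) //.
    by rewrite -natrX ler_nat ltnW // ltn_expl.
  have Lr : L n < r by rewrite (le_lt_trans _ big) // ler_wpM2r ?invr_ge0 // lerDl.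
  have Mr : M n < r by rewrite (le_lt_trans _ big) // ler_wpM2r ?invr_ge0 // lerDr.
  have [Hn In] := sP n; apply: (le_trans In).
  have := rP _ _ _ _ (L0 n) (M0 n) Lr Mr (aP n) (bP n) Hn.
  rewrite -(ler_pM2l (_ : 0 < 4 ^+ n)) ?exprn_gt0 // => /le_trans; apply.
  rewrite /L /M -mulrDl expr_div_n -exprM mulnC exprM.
  have -> : (2 ^+ 2 : R) = 4 by rewrite expr2; lra.
  rewrite mulrCA [_ ^+ 2 / _]mulrC [4 ^+ n * _]mulrA divff ?mul1r ?gt_eqF ?exprn_gt0 //.
apply/eqP; rewrite -normr_le0; apply/ler_addgt0Pr => e e0; rewrite add0r.
pose c := 2 * (l + m) ^+ 2 + 1; have c0 : 0 < c by rewrite ltr_wpDl // mulr_ge0 // sqr_ge0.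
apply: le_trans (small (e / c) (divr_gt0 e0 c0)) _.
rewrite mulrAC mulrA -ler_pdivlMr ?invr_gt0 // invrK mulrC ler_pM2l // /c; lra.
Qed.

End Goursat.

(** * The maximum principle *)

Section MaximumPrinciple.
Context {R : realType}.
Local Notation C := (Cplx R).
Implicit Types (K : C -> C) (p v : C) (rho rad : R).

Lemma holo_at_differentiable K (x y : R) : differentiable K (Complex x y : C) ->
  holo_at (fun s t => ReC (K (Complex s t))) (fun s t => ImC (K (Complex s t))) x y.
Proof.
move=> /differentiableC_approx[d H]; exists (ReC d), (ImC d) => e e0.
have [r r0 {}H] := H e e0; exists (r / 2); first by rewrite divr_gt0.
move=> h k hr kr; pose w : C := Complex h k.
have wr : cmod w <= `|h| + `|k| by exact: cmod_le_ReIm.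
have {H} := H w (le_lt_trans wr _).
have -> : `|h| + `|k| < r by rewrite (splitr r) ltrD.
have -> : (Complex x y : C) + w = Complex (x + h) (y + k) by [].
move=> /(_ isT) H; split; apply: le_trans (ler_wpM2l (ltW e0) wr); apply: le_trans H.
  by rewrite (le_trans _ (ReC_le_cmod _)) // !(ReCB, ReCM).
rewrite (le_trans _ (ImC_le_cmod _)) // !(ImCB, ImCM).
by rewrite [ImC d * _ + _]addrC.
Qed.

(* In the coordinate s + it = log (v - p), Goursat makes the integral of Re K
   over a circle independent of its radius; let the radius tend to 0. *)
Lemma max_principle_Re K p rho rad (M : R) : 0 < rho -> rho < rad ->
  (forall v, v != p -> cmod (v - p) < rad -> differentiable K v) ->
  {for p, continuous K} ->
  (forall v, cmod (v - p) = rho -> ReC (K v) <= M) -> ReC (K p) <= M.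
Proof.
move=> r0 rr0 dK cK KM; rewrite leNgt; apply/negP => Mp.
pose k z := K (p + cexp z).
pose P s t := ReC (k (Complex s t)); pose Q s t := ImC (k (Complex s t)).
have dk z : expR (ReC z) < rad -> differentiable k z.
  move=> zr; apply: (differentiable_fcomp (g := K)).
    apply: differentiable_cst_add; exact: differentiable_cexp.
  apply: dK; last by rewrite addrAC subrr add0r cmod_cexp.
  by rewrite -subr_eq0 addrAC subrr add0r -cmod_eq0 cmod_cexp gt_eqF ?expR_gt0.
(* Half the gap, so that M + e = Re K(p) - e: near p the real part stays above M + e. *)
pose e := (ReC (K p) - M) / 2; have e0 : 0 < e by rewrite divr_gt0 ?subr_gt0.
have [dl dl0 Hd] := (continuousC_deltaP K p).1 cK e e0.
(* The vertical sides s = S and s = s0 of the rectangle are the circle of radius rho and a circle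
   inside the continuity radius dl. *)
pose S := ln rho; pose s0 := Num.min S (ln (dl / 2)).
have eS : expR S = rho by rewrite lnK.
have s0S : s0 <= S by rewrite ge_min lexx.
have es0 : expR s0 < dl.
  apply: (@le_lt_trans _ _ (dl / 2)); last by rewrite gtr_pMr // invf_lt1 // ltr1n.
  by rewrite -[leRHS]lnK ?posrE ?divr_gt0 // ler_expR ge_min lexx orbT.
have hol s t : s <= S -> holo_at P Q s t.
  move=> sS; apply: (@holo_at_differentiable k); apply: dk.
  by rewrite (le_lt_trans _ rr0) // -eS ler_expR.
have pi2 : 0 <= 2 * pi :> R by rewrite mulr_ge0 // pi_ge0.
have box : holo_box P Q s0 0 (S - s0) (2 * pi).
  by move=> u v /andP[_ +] _; rewrite addrC subrK => /hol; apply.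
have := goursat (_ : 0 <= S - s0) pi2 box; rewrite subr_ge0 => /(_ s0S).
rewrite /circulation [s0 + _]addrC subrK add0r.
(* The horizontal sides t = 0 and t = 2 pi have the same image under exp, so they cancel. *)
have -> : (fun u => Q u 0 - Q u (2 * pi)) = fun=> 0.
  apply/funext => u; rewrite /Q /k /cexp /ReC /ImC /=.
  have -> : (2 * pi : R) = 0 + pi *+ 2 by rewrite add0r mulr_natl.
  by rewrite sinD2pi cosD2pi subrr.
rewrite Int_cst // mul0r add0r.
have seg s : s <= S -> cont_seg 0 (2 * pi) (P s).
  by move=> sS t _; case: (holo_at_cont (hol s t sS)).
rewrite (IntB (seg S (lexx S)) (seg s0 s0S)) => /eqP; rewrite subr_eq0 => /eqP I.
have lo : (M + e) * (2 * pi - 0) <= Int 0 (2 * pi) (P s0).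
  rewrite -Int_cst //; apply: le_Int; [exact: cont_seg_cst|exact: seg|move=> t _].
  have := Hd (p + cexp (Complex s0 t)); rewrite addrAC subrr add0r cmod_cexp.
  move=> /(_ es0) /(le_lt_trans (ReC_le_cmod _)); rewrite ReCB /P /k ltr_norml.
  have -> : M + e = ReC (K p) - e by rewrite /e; field.
  by rewrite ltrBrDr addrC => /andP[/ltW].
have hi : Int 0 (2 * pi) (P S) <= M * (2 * pi - 0).
  rewrite -Int_cst //; apply: le_Int; [exact: seg|exact: cont_seg_cst|move=> t _].
  by apply: KM; rewrite addrAC subrr add0r cmod_cexp.
rewrite I in hi; have := le_trans lo hi.
by rewrite subr0 ler_pM2r ?mulr_gt0 ?pi_gt0 // leNgt ltrDl e0.
Qed.

(** Multiplying K by a constant of modulus 1 makes K(p) real and nonnegative, which reduces the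
    modulus to the real part. *)
Lemma max_principle K p rho rad (M : R) : 0 < rho -> rho < rad ->
  (forall v, v != p -> cmod (v - p) < rad -> differentiable K v) ->
  {for p, continuous K} ->
  (forall v, cmod (v - p) = rho -> cmod (K v) ^+ 2 <= M) -> cmod (K p) ^+ 2 <= M.
Proof.
move=> r0 rr0 dK cK KM.
have M0 : 0 <= M.
  apply: le_trans (KM (p + toC rho) _); first exact: sqr_ge0.
  by rewrite addrAC subrr add0r cmod_toC gtr0_norm.
have [Kp|Kp] := eqVneq (K p) 0; first by rewrite Kp cmod0 expr0n.
pose c := toC (cmod (K p)) / K p.
have c1 : cmod c = 1.
  by rewrite cmodM cmodV cmod_toC ger0_norm ?cmod_ge0 // divff // cmod_eq0.
have le v : cmod (K v) ^+ 2 <= M -> cmod (K v) <= Num.sqrt M.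
  by move=> h; rewrite -[cmod _]ger0_norm ?cmod_ge0 // -sqrtr_sqr ler_wsqrtr.
have := @max_principle_Re (fun v => c * K v) p rho rad (Num.sqrt M) r0 rr0.
have -> : c * K p = toC (cmod (K p)) by rewrite /c divfK.
rewrite ReC_toC => H; rewrite -[leRHS]sqr_sqrtr // ler_pXn2r ?nnegrE ?cmod_ge0 ?sqrtr_ge0 //.
apply: H.
- by move=> v vp vr; apply: differentiable_cst_mul; exact: dK.
- exact: continuous_cst_mul.
- move=> v /KM /le h; apply: le_trans h.
  by rewrite (le_trans (ler_norm _)) // (le_trans (ReC_le_cmod _)) // cmodM c1 mul1r.
Qed.

End MaximumPrinciple.

(** * Log-subharmonic functions *)

Section LogSubharmonic.
Context {R : realType}.
Local Notation C := (Cplx R).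
Implicit Types (K G : C -> C) (E : C -> R) (a p v w : C).

(** The parameter A covers at once the circle (A = {r}) and the closed disk (A everything).
    Compactness comes from the square [-r, r]^2 under (x, y) -> x + iy. *)
Lemma compact_cmod (A : set R) r : closed A ->
  compact [set w : C | A (cmod w) /\ cmod w <= r].
Proof.
move=> Acl.
pose f (x : R * R) : C := Complex x.1 x.2.
have cf : continuous f.
  move=> x; apply: continuous_Complex; [exact: cvg_fst|exact: cvg_snd].
have := compact_setX (@segment_compact R (- r) r) (@segment_compact R (- r) r).
move=> /(continuous_compact (continuous_subspaceT cf)) Kc.
apply: (subclosed_compact _ Kc).
  have -> : [set w : C | A (cmod w) /\ cmod w <= r] = cmod @^-1` (A `&` [set x | x <= r]).
    by [].
  apply: preimage_closed; first by move=> w _; exact: continuous_cmod.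
  by apply: closedI => //; exact: closed_le.
move=> w /= [_ wr]; exists (ReC w, ImC w); last by case: (w).
split; rewrite /= in_itv /= -ler_norml.
  exact: le_trans (ReC_le_cmod w) wr.
exact: le_trans (ImC_le_cmod w) wr.
Qed.

(* log E is subharmonic at p up to o(|v - p|^2); allowing G to be merely
   continuous at p covers removable singularities. *)
Definition log_subharmonic_at E p := forall e : R, 0 < e ->
  exists2 rad : R, 0 < rad & forall c : R, 0 < c -> c < E p -> exists G,
    [/\ forall v, v != p -> cmod (v - p) < rad -> differentiable G v,
        {for p, continuous G}, c <= cmod (G p) ^+ 2 &
        forall v, cmod (v - p) < rad ->
          cmod (G v) ^+ 2 <= E v * expR (e * cmod (v - p) ^+ 2)].

(** Around p, |v|^2 is the real part of an affine holomorphic function plus |v - p|^2; this allows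
    e|w|^2 to be traded for a holomorphic exponent. *)
Lemma cmod_sqr_shift p v :
  cmod v ^+ 2 = cmod p ^+ 2 + 2 * ReC (conjc p * (v - p)) + cmod (v - p) ^+ 2.
Proof.
rewrite !cmod_sqr ReCM; case: p v => a b [c d]; rewrite /ReC /ImC /=; ring.
Qed.

(** Replacing m by max(m, V / 2) covers m = 0; the exponent e r^2 is then half of log(V / m'). *)
Lemma expR_scale (m V r : R) : 0 <= m -> m < V -> 0 < r ->
  exists2 e : R, 0 < e & m * expR (e * r ^+ 2) < V.
Proof.
move=> m0 mV r0; pose m' := Num.max m (V / 2).
have V0 : 0 < V by exact: le_lt_trans mV.
have m'0 : 0 < m' by rewrite lt_max divr_gt0 ?orbT.
have m'V : m' < V by rewrite gt_max mV gtr_pMr // invf_lt1 // ltr1n.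
have q1 : 1 < V / m' by rewrite ltr_pdivlMr // mul1r.
exists (ln (V / m') / 2 / r ^+ 2); first by rewrite !divr_gt0 ?exprn_gt0 // ln_gt0.
rewrite divfK ?gt_eqF ?exprn_gt0 //.
apply: (@le_lt_trans _ _ (m' * expR (ln (V / m') / 2))).
  by rewrite ler_wpM2r ?expR_ge0 // le_max lexx.
rewrite -ltr_pdivlMl // [m'^-1 * _]mulrC -[ltRHS]lnK ?posrE ?divr_gt0 // ltr_expR.
by rewrite gtr_pMr ?ln_gt0 // invf_lt1 // ltr1n.
Qed.

(* At an interior maximum w0 of V(w) exp(e|w|^2), V(w) the product below, the
   function prod_k G_k * exp(e conj(w0) (w - w0)) built from the G_k of
   log_subharmonic_at would violate the maximum principle. *)
Lemma log_subharmonic_max E a (r : R) N (z : nat -> C) w1 : 0 < r ->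
  (forall v, cmod (v - a) <= r -> 0 <= E v) ->
  (forall v, cmod (v - a) <= r -> {for v, continuous E}) ->
  (forall v, cmod (v - a) < r -> log_subharmonic_at E v) ->
  (forall k, cmod (z k) = 1) -> cmod w1 <= r ->
  exists2 w, cmod w = r & \prod_(k < N) E (a + z k * w1) <= \prod_(k < N) E (a + z k * w).
Proof.
move=> r0 E0 cE lE z1 w1r; apply: contrapT => nex.
pose V w := \prod_(k < N) E (a + z k * w).
have cmodz k w : cmod (a + z k * w - a) = cmod w by rewrite addrAC subrr add0r cmodM z1 mul1r.
have V0 w : cmod w <= r -> 0 <= V w.
  by move=> wr; apply: prodr_ge0 => k _; apply: E0; rewrite cmodz.
have cV w : cmod w <= r -> {for w, continuous V}.
  move=> wr; apply: continuous_fprod => k.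
  apply: (continuous_fcomp (g := E)); last by apply: cE; rewrite cmodz.
  apply: differentiable_continuous; exact: differentiable_affine.
have lt w : cmod w = r -> V w < V w1.
  by move=> wr; rewrite ltNge; apply/negP => ?; apply: nex; exists w.
have [m [m0 mlt mle]] : exists m, [/\ 0 <= m, m < V w1 & forall w, cmod w = r -> V w <= m].
  have := @compact_EVT_max _ _ V [set w : C | [set r] (cmod w) /\ cmod w <= r].
  case.
  - by exists (toC r); rewrite /= cmod_toC gtr0_norm.
  - by apply: compact_cmod; exact: (@closed_eq R r).
  - by apply: continuous_in_subspaceT => w; rewrite inE => -[_ wr]; exact: cV.
  move=> w2 /[1!inE] -[/= w2r w2r'] H; exists (V w2); split.
  - exact: V0.
  - exact: lt.
  - by move=> w wr; apply: H; rewrite inE; split => //=; rewrite wr.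
(* With this e, the function W below stays under V w1 on the boundary circle, while W(w1) >= V w1;
   its maximum is therefore interior. *)
have [e e0 em] := expR_scale m0 mlt r0.
pose W w := V w * expR (e * cmod w ^+ 2).
have [w0 w0r w0max] : exists2 w0, cmod w0 <= r & forall w, cmod w <= r -> W w <= W w0.
  have := @compact_EVT_max _ _ W [set w : C | setT (cmod w) /\ cmod w <= r].
  case.
  - by exists 0; rewrite /= cmod0; split => //; exact: ltW.
  - by apply: compact_cmod; exact: closedT.
  - apply: continuous_in_subspaceT => w; rewrite inE => -[_ wr].
    apply: continuous_mul; first exact: cV.
    apply: (continuous_fcomp (g := expR)); last exact: continuous_expR.
    apply: continuous_cst_mul; apply: continuous_mul; exact: continuous_cmod.
  move=> w0 /[1!inE] -[_ w0r] H; exists w0 => // w wr.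
  by apply: H; rewrite inE.
have Ww1 : V w1 <= W w0.
  apply: le_trans (w0max w1 w1r); rewrite ler_peMr ?V0 //.
  by rewrite -expR0 ler_expR mulr_ge0 ?sqr_ge0 // ltW.
have w0lt : cmod w0 < r.
  rewrite lt_neqAle w0r andbT; apply/eqP => w0r'.
  move: Ww1; apply/negP; rewrite -ltNge; apply: le_lt_trans em.
  by rewrite /W w0r' ler_wpM2r ?expR_ge0 // mle.
have Vw0 : 0 < V w0.
  have : 0 < W w0 by apply: lt_le_trans Ww1; exact: le_lt_trans mlt.
  by rewrite /W pmulr_lgt0 // expR_gt0.
pose p (k : 'I_N) := a + z k * w0.
have Ep k : 0 < E (p k).
  rewrite lt_def E0 ?cmodz // andbT; apply/eqP => Ek0.
  by move: Vw0; rewrite /V (bigD1 k) //= -/(p k) Ek0 mul0r ltxx.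
(* N + 1 in place of N keeps the quotients meaningful for N = 0; only N / N1 <= 1 matters. *)
pose N1 : R := N.+1%:R; have N10 : 0 < N1 by rewrite ltr0n.
have e'0 : 0 < e / (2 * N1) by rewrite divr_gt0 // mulr_gt0.
have /choice[rad radP] : forall k : 'I_N, exists rad : R, 0 < rad /\
    forall c : R, 0 < c -> c < E (p k) -> exists G,
    [/\ forall v, v != p k -> cmod (v - p k) < rad -> differentiable G v,
        {for p k, continuous G}, c <= cmod (G (p k)) ^+ 2 &
        forall v, cmod (v - p k) < rad ->
          cmod (G v) ^+ 2 <= E v * expR (e / (2 * N1) * cmod (v - p k) ^+ 2)].
  move=> k; have pk : cmod (p k - a) < r by rewrite cmodz.
  by have [rad rad0 H] := lE _ pk _ e'0; exists rad.
(* One radius for all N factors, small enough for circles around w0 to stay in the closed disk of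
   radius r. *)
pose rm := \big[Num.min/(r - cmod w0)]_(k < N) rad k.
have rm0 : 0 < rm by apply: lt_bigmin => [|k _]; [rewrite subr_gt0|case: (radP k)].
have rmk k : rm <= rad k by exact: bigmin_le.
have rmw : rm <= r - cmod w0 by exact: bigmin_le_id.
pose rho := rm / 2; have rho0 : 0 < rho by rewrite divr_gt0.
have rhom : rho < rm by rewrite gtr_pMr // invf_lt1 // ltr1n.
pose t := expR (- (e * rho ^+ 2 / (4 * N1))).
have t1 : t < 1.
  by rewrite -expR0 ltr_expR oppr_lt0 divr_gt0 ?mulr_gt0 // exprn_gt0.
have /choice[G GP] : forall k : 'I_N, exists G : C -> C,
    [/\ forall v, v != p k -> cmod (v - p k) < rad k -> differentiable G v,
        {for p k, continuous G}, E (p k) * t <= cmod (G (p k)) ^+ 2 &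
        forall v, cmod (v - p k) < rad k ->
          cmod (G v) ^+ 2 <= E v * expR (e / (2 * N1) * cmod (v - p k) ^+ 2)].
  by move=> k; apply: (radP k).2; rewrite ?mulr_gt0 ?expR_gt0 // gtr_pMr.
have pkw (k : 'I_N) w : a + z k * w - p k = z k * (w - w0) by rewrite /p; ring.
have cpkw (k : 'I_N) w : cmod (a + z k * w - p k) = cmod (w - w0) by rewrite pkw cmodM z1 mul1r.
pose K w := (\prod_(k < N) G k (a + z k * w)) * cexp (toC e * conjc w0 * (w - w0)).
(* The budget on the circle |w - w0| = rho: maximality of W together with the exponent of K gains e
   rho^2, and the errors of the N factors cost at most e rho^2 / 2, leaving this M. At the centre
   the N factors t cost at most e rho^2 / 4 in the exponent, so |K(w0)|^2 exceeds M. *)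
pose M := V w0 * expR (- (e * rho ^+ 2 / 2)).
have dexp v : differentiable (fun w => cexp (toC e * conjc w0 * (w - w0))) v.
  apply: (differentiable_fcomp (g := cexp)); last exact: differentiable_cexp.
  exact: differentiable_mul_shift.
have : cmod (K w0) ^+ 2 <= M.
  apply: (@max_principle _ K w0 rho rm) => //.
  - move=> v vw vr; apply: differentiable_mul; last exact: dexp.
    apply: differentiable_prod => k.
    apply: (differentiable_fcomp (g := G k)); first exact: differentiable_affine.
    have [+ _ _ _] := GP k; apply; last by rewrite cpkw (lt_le_trans vr).
    by rewrite -subr_eq0 -cmod_eq0 cpkw cmod_eq0 subr_eq0.
  - apply: continuous_mul; last by apply: differentiable_continuous; exact: dexp.
    apply: continuous_fprod => k.
    apply: (continuous_fcomp (g := G k)); last by case: (GP k).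
    by apply: differentiable_continuous; exact: differentiable_affine.
  - move=> w wrho.
    have wr : cmod w <= r.
      rewrite -[w](subrK w0) (le_trans (cmodD _ _)) // wrho -lerBrDr.
      exact: le_trans (ltW rhom) rmw.
    rewrite cmodM exprMn cmod_cexp cmod_prod -expRM_natr -prodrXl.
    apply: (@le_trans _ _ (V w * expR (e / (2 * N1) * rho ^+ 2) ^+ N *
      expR (e * (cmod w ^+ 2 - cmod w0 ^+ 2 - rho ^+ 2)))).
      have -> : ReC (toC e * conjc w0 * (w - w0)) * 2 = e * (cmod w ^+ 2 - cmod w0 ^+ 2 - rho ^+ 2).
        rewrite (cmod_sqr_shift w0 w) wrho -mulrA ReCM ReC_toC ImC_toC; ring.
      rewrite ler_wpM2r ?expR_ge0 //.
      have -> : expR (e / (2 * N1) * rho ^+ 2) ^+ N =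
          \prod_(k < N) expR (e / (2 * N1) * rho ^+ 2) by rewrite prodr_const card_ord.
      rewrite /V -big_split; apply: ler_prod => k _ /=.
      rewrite sqr_ge0 /= -wrho -(cpkw k w); case: (GP k) => _ _ _; apply.
      by rewrite cpkw wrho (lt_le_trans rhom).
    have := w0max w wr; rewrite /W -ler_pdivlMr ?expR_gt0 // -expRN => Vw.
    rewrite -mulrA -expRM_natr -expRD.
    apply: le_trans (ler_wpM2r (expR_ge0 _) Vw) _.
    set q := e / (2 * N1) * rho ^+ 2 * N%:R.
    suff qle : q <= e * rho ^+ 2 / 2.
      rewrite /M -[leLHS]mulrA -[leLHS]mulrA ler_pM2l // -!expRD ler_expR.
      by move: q qle => q; lra.
    have NN : N%:R / N1 <= 1 by rewrite ler_pdivrMr // mul1r ler_nat.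
    have -> : q = (e * rho ^+ 2 / 2) * (N%:R / N1).
      by rewrite /q; field; rewrite gt_eqF.
    by rewrite ler_piMr // divr_ge0 // mulr_ge0 ?sqr_ge0 // ltW.
apply/negP; rewrite -ltNge.
apply: (@lt_le_trans _ _ (V w0 * t ^+ N)); last first.
  rewrite /K subrr mulr0 cexp0 mulr1 cmod_prod -prodrXl.
  have -> : t ^+ N = \prod_(k < N) t by rewrite prodr_const card_ord.
  rewrite /V -big_split; apply: ler_prod => k _ /=.
  by rewrite mulr_ge0 ?expR_ge0 ?(ltW (Ep k)) //=; case: (GP k).
rewrite /M ltr_pM2l // /t -expRM_natr ltr_expR mulNr ltrN2.
have NN : N%:R / N1 <= 1 by rewrite ler_pdivrMr // mul1r ler_nat.
have er0 : 0 < e * rho ^+ 2 by rewrite mulr_gt0 // exprn_gt0.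
have -> : e * rho ^+ 2 / (4 * N1) * N%:R = (e * rho ^+ 2 / 4) * (N%:R / N1).
  by field; rewrite gt_eqF.
apply: (@le_lt_trans _ _ (e * rho ^+ 2 / 4)); last by lra.
by rewrite ler_piMr //; lra.
Qed.

(* The maximum principle for |G(w)/w|^2 *)
Lemma schwarz G (M : R) : 0 <= M -> (forall v, cmod v <= 1 -> differentiable G v) ->
  G 0 = 0 -> (forall v, cmod v <= 1 -> cmod (G v) <= M) ->
  forall v, cmod v <= 1 -> cmod (G v) <= M * cmod v.
Proof.
move=> M0 dG G0 GM v v1; have [->|v0] := eqVneq v 0; first by rewrite G0 cmod0 mulr0.
have [d dP] : exists d : C, forall e : R, 0 < e -> exists2 r : R, 0 < r &
    forall h, cmod h < r -> cmod (G h - d * h) <= e * cmod h.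
  have [|d H] := differentiableC_approx (dG 0 _); first by rewrite cmod0.
  exists d => e e0; have [r r0 {}H] := H e e0; exists r => // h /H.
  by rewrite add0r G0 subr0.
(* The value at 0 is the derivative of G there, which makes q continuous. *)
pose q w := if w == 0 then d else G w / w.
have qE w : w != 0 -> q w = G w / w by rewrite /q => /negbTE ->.
have cq0 : {for 0, continuous q}.
  apply/continuousC_deltaP => e e0.
  have [|r r0 H] := dP (e / 2); first by rewrite divr_gt0.
  exists r => // w; rewrite subr0 => wr; have [->|w0] := eqVneq w 0.
    by rewrite subrr cmod0.
  have c0 : 0 < cmod w by rewrite cmod_gt0.
  have -> : q w - q 0 = (G w - d * w) / w by rewrite qE // /q eqxx mulrBl mulfK.
  rewrite cmodM cmodV ltr_pdivrMr //; apply: le_lt_trans (H w wr) _.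
  by rewrite ltr_pM2r // gtr_pMr // invf_lt1 // ltr1n.
have dq w : w != 0 -> cmod w <= 1 -> differentiable q w.
  move=> w0 w1.
  have H : differentiable (fun w => G w / w) w.
    exact: (differentiable_quotient w0 (dG w w1)).
  apply: eq_off_differentiable H.
  have : \forall u \near w, cmod (u - w) < cmod w by apply: near_cmod; rewrite cmod_gt0.
  apply: filterS => u uw; rewrite /= qE //; apply: contraTneq uw => ->.
  by rewrite sub0r cmodN ltxx.
have cq w : cmod w <= 1 -> {for w, continuous q}.
  by move=> w1; have [->//|w0] := eqVneq w 0; apply: differentiable_continuous; exact: dq.
pose E w := cmod (q w) ^+ 2.
have cE w : cmod w <= 1 -> {for w, continuous E}.
  move=> w1; have c1 : {for w, continuous (fun w => cmod (q w))}.
    by apply: (continuous_fcomp (g := cmod)); [exact: cq|exact: continuous_cmod].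
  exact: continuous_mul.
have lE w : cmod w < 1 -> log_subharmonic_at E w.
  move=> w1 e e0.
  (* The punctured disk around w must avoid 0 and stay in the unit disk. At w = 0 the puncture
     itself removes 0, and elsewhere |w| bounds the radius. *)
  have [rad rad0 radP] : exists2 rad : R, 0 < rad & forall u, u != w -> cmod (u - w) < rad ->
      u != 0 /\ cmod u <= 1.
    have [w0|w0] := eqVneq w 0.
      by exists 1 => // u; rewrite w0 subr0 => u0 /ltW.
    exists (Num.min (cmod w) (1 - cmod w)); first by rewrite lt_min cmod_gt0 w0 subr_gt0.
    move=> u uw; rewrite lt_min => /andP[u1 u2]; split.
      by apply: contraTneq u1 => ->; rewrite sub0r cmodN ltxx.
    by rewrite -[u](subrK w) (le_trans (cmodD _ _)) // -lerBrDr ltW.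
  exists rad => // c c0 cEw; exists q; split.
  - by move=> u uw /(radP u uw)[u0 u1]; exact: dq.
  - exact/cq/ltW.
  - exact: ltW.
  - move=> u _; rewrite /E ler_peMr ?sqr_ge0 // -expR0 ler_expR mulr_ge0 ?sqr_ge0 //.
    exact: ltW.
(* With a single factor and trivial rotation this is the ordinary maximum principle on the unit
   disk. *)
have := @log_subharmonic_max E 0 1 1 (fun=> 1) v ltr01.
case.
- by move=> w _; exact: sqr_ge0.
- by move=> w; rewrite subr0; exact: cE.
- by move=> w; rewrite subr0; exact: lE.
- by move=> _; exact: cmod1.
- exact: v1.
move=> w w1; rewrite !big_ord1 !add0r !mul1r /E ler_pXn2r ?nnegrE ?cmod_ge0 //.
have w0 : w != 0 by rewrite -cmod_gt0 w1.
rewrite !qE // !cmodM !cmodV w1 invr1 mulr1 ler_pdivrMr ?cmod_gt0 // => /le_trans; apply.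
by rewrite ler_wpM2r ?cmod_ge0 // GM ?w1.
Qed.

End LogSubharmonic.

(** * Averages over circles *)

Section CircleMean.
Context {R : realType}.
Implicit Types (g h : R -> R).

(** Uniform continuity from compactness of the segment. Only x is confined to it, so sample points
    playing the part of y need no membership check. *)
Lemma heine h (a b : R) : continuous h -> forall e : R, 0 < e ->
  exists2 d : R, 0 < d & forall x y, a <= x <= b -> `|x - y| < d -> `|h x - h y| < e.
Proof.
move=> ch e e0.
have := (compact_near_coveringP _).1 (@segment_compact R a b).
move=> /(_ R (0^'+) (fun d x => forall y, `|x - y| < d -> `|h x - h y| < e) _).
case=> [x _|d /= d0 H].
  have e2 : 0 < e / 2 by rewrite divr_gt0.
  have /cvgrPdist_lt/(_ _ e2)/nbhs_ballP[r /= r0 rP] := ch x.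
  have r2 : 0 < r / 2 by rewrite divr_gt0.
  exists (ball x (r / 2), [set d | d < r / 2]) => /=.
    by split; [exact: nbhsx_ballx|exact: nbhs_right_lt].
  move=> [x' d] /= [xx' dr] y x'y.
  have h1 : `|h x - h x'| < e / 2.
    by apply: rP; rewrite /ball /= (lt_le_trans xx') // ler_pdivrMr // ler_peMr ?ler1n // ltW.
  have h2 : `|h x - h y| < e / 2.
    apply: rP; rewrite /ball /= -(subrK x' x) -addrA (le_lt_trans (ler_normD _ _)) //.
    by rewrite (splitr r) ltrD // (lt_trans x'y).
  rewrite -(subrK (h x) (h x')) -addrA (le_lt_trans (ler_normD _ _)) //.
  by rewrite (splitr e) ltrD // distrC.
pose d1 := d / 2; have d10 : 0 < d1 by rewrite divr_gt0.
have d1d : d1 < d by rewrite gtr_pMr // invf_lt1 // ltr1n.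
exists d1 => // x y xab xy; apply: (H d1) => //.
by rewrite /ball /= sub0r normrN gtr0_norm.
Qed.

Lemma Int_cells h (d e : R) N (x : nat -> R) : continuous h -> 0 <= d ->
  (forall k, (k < N)%N -> forall t, k%:R * d <= t <= k.+1%:R * d -> h (x k) - e <= h t) ->
  d * \sum_(k < N) (h (x k) - e) <= Int 0 (N%:R * d) h.
Proof.
move=> ch d0; have seg a b : cont_seg a b h by move=> t _; exact: ch.
elim: N => [|N IH] H.
  rewrite big_ord0 mulr0 mul0r /Int /Rintegral set_itv1 integral_set1 //.
have Nd : 0 <= N%:R * d by rewrite mulr_ge0.
have NS : N%:R * d <= N.+1%:R * d by rewrite ler_wpM2r // ler_nat.
rewrite big_ord_recr /= mulrDr (Int_cat Nd NS) // lerD //.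
  by apply: IH => k kN; apply: H; rewrite ltnW.
have -> : d * (h (x N) - e) = (h (x N) - e) * (N.+1%:R * d - N%:R * d).
  by rewrite -mulrBl -natr1 addrAC subrr add0r mul1r mulrC.
rewrite -Int_cst //; apply: le_Int => //; first exact: cont_seg_cst.
exact: H.
Qed.

(** Shifting by one step moves a single factor from one end of a full period to the other. This
    serves to reduce the offset of a Riemann sum modulo its step. *)
Lemma prod_cyclic_shift (b : nat -> R) N j : (forall k, b (k + N)%N = b k) ->
  \prod_(k < N) b (k + j)%N = \prod_(k < N) b k.
Proof.
move=> bN; elim: j => [|j <-]; first by apply: eq_bigr => k _; rewrite addn0.
case: N bN => [|N] bN; first by rewrite !big_ord0.
rewrite big_ord_recr big_ord_recl /= add0n mulrC; congr (_ * _).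
  by rewrite -addSnnS addnC bN.
by apply: eq_bigr => k _; rewrite addnS.
Qed.

Let tau : R := 2 * pi.
Let tau0 : 0 < tau. Proof. by rewrite mulr_gt0 // pi_gt0. Qed.

(* Riemann sums at equidistant points converge uniformly in the offset th *)
Lemma ln_le_mean g (A eta : R) : continuous g -> (forall t, g (t + tau) = g t) ->
  (forall t, 0 <= g t) -> 0 < A -> 0 < eta ->
  (forall N, (0 < N)%N -> exists2 th, 0 <= th &
     A ^+ N <= \prod_(k < N) g (th + k%:R * (tau / N%:R))) ->
  ln A * tau <= Int 0 tau (fun t => ln (g t + eta)).
Proof.
move=> cg pg g0 A0 eta0 H; set h := fun t => ln (g t + eta).
have ge0 t : 0 < g t + eta by rewrite ltr_wpDl.
have ch : continuous h.
  move=> t; apply: (@continuous_fcomp _ _ _ (fun t => g t + eta) (@ln R)).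
    by apply: continuousD; [exact: cg|exact: cst_continuous].
  exact: continuous_ln.
apply/ler_addgt0Pr => e e0.
pose e' := e / tau; have e'0 : 0 < e' by rewrite divr_gt0.
have [d d0 hd] := heine 0 tau ch e'0.
pose N := (Num.bound (tau / d)).+1.
have N0 : 0 < N%:R :> R by rewrite ltr0n.
pose dl := tau / N%:R; have dl0 : 0 < dl by rewrite divr_gt0.
have dld : dl < d.
  rewrite ltr_pdivrMr // mulrC -ltr_pdivrMr // (lt_trans (archi_boundP _)) ?ltr_nat //.
  by rewrite divr_ge0 ?ltW.
have Ndl : N%:R * dl = tau by rewrite mulrC divfK // gt_eqF.
have [th th0 Hth] := H N isT.
(* Removing whole steps from the offset only permutes the samples, as g is [tau]-periodic. With 0 <=
   th' < dl the k-th sample falls in the k-th cell. *)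
pose j := Num.truncn (th / dl); pose th' := th - j%:R * dl.
have [j1 j2] : j%:R * dl <= th /\ th < j.+1%:R * dl.
  have := truncn_itv (divr_ge0 th0 (ltW dl0)); rewrite -/j => /andP[].
  by rewrite ler_pdivlMr // ltr_pdivrMr.
have th'1 : 0 <= th' < dl.
  by rewrite subr_ge0 j1 /= ltrBlDr -[X in X + _]mul1r -mulrDl nat1r.
pose x k : R := th' + k%:R * dl.
have prodx : A ^+ N <= \prod_(k < N) g (x k).
  apply: le_trans Hth _; rewrite -(@prod_cyclic_shift (fun k => g (x k)) N j).
    rewrite le_eqVlt; apply/orP; left; apply/eqP; apply: eq_bigr => k _.
    by congr g; rewrite /x /th' natrD mulrDl -/dl; ring.
  by move=> k; rewrite /x natrD mulrDl Ndl addrA pg.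
have sumx : N%:R * ln A <= \sum_(k < N) h (x k).
  rewrite -ler_expR.
  have -> : expR (N%:R * ln A) = A ^+ N by rewrite mulrC expRM_natr lnK.
  rewrite expR_sum (le_trans prodx) //; apply: ler_prod => k _.
  by rewrite g0 /= /h lnK ?posrE // lerDl ltW.
have cell k : (k < N)%N -> forall t, k%:R * dl <= t <= k.+1%:R * dl -> h (x k) - e' <= h t.
  move=> kN t tk.
  have [t1 t2] : k%:R * dl <= t /\ t <= k%:R * dl + dl.
    by move: tk; rewrite -natr1 mulrDl mul1r => /andP[].
  have tt : 0 <= t <= tau.
    apply/andP; split; first by apply: le_trans t1; rewrite mulr_ge0 // ltW.
    apply: (le_trans t2).
    by rewrite -Ndl -[X in _ + X]mul1r -mulrDl natr1 ler_wpM2r ?(ltW dl0) // ler_nat.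
  have := hd t (x k) tt _.
  have -> : `|t - x k| < d.
    by move: th'1 => /andP[? ?]; rewrite (le_lt_trans _ dld) // /x ler_norml; lra.
  by move=> /(_ isT); rewrite ltr_norml => /andP[+ _]; lra.
have := Int_cells ch (ltW dl0) cell; rewrite Ndl => cells.
rewrite -lerBlDr; apply: le_trans cells.
rewrite sumrB sumr_const card_ord mulrBr -[e' *+ N]mulr_natl.
rewrite [dl * (_ * e')]mulrA [dl * N%:R]mulrC Ndl [tau * e']mulrC divfK ?gt_eqF // lerD2r.
by apply: le_trans (ler_wpM2l (ltW dl0) sumx); rewrite [dl * _]mulrA [dl * N%:R]mulrC Ndl mulrC.
Qed.

Local Open Scope ereal_scope.
Local Notation mu := (@lebesgue_measure R).

(** The case with eta = 1 / (n + 1) is [ln_le_mean]; letting n grow, monotone convergence handles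
    the zeros of g, where the integrand is -oo. *)
Lemma lne_le_mean g (A : R) : continuous g -> (forall t, g (t + tau)%R = g t) ->
  (forall t, 0 <= g t)%R -> (0 <= A)%R ->
  (forall N, (0 < N)%N -> exists2 th, (0 <= th)%R &
     (A ^+ N <= \prod_(k < N) g (th + k%:R * (tau / N%:R)))%R) ->
  lne A%:E <= (tau^-1)%:E * \int[mu]_(t in `[0%R, tau]) lne (g t)%:E.
Proof.
move=> cg pg g0 A0 H; have [->|Apos] := eqVneq A 0%R.
  by rewrite le0_lneNy // leNye.
have {A0} Apos : (0 < A)%R by rewrite lt_def Apos A0.
have [c _ cmax] := @EVT_max R g 0%R tau (ltW tau0) (continuous_subspaceT cg).
(* C dominates log(g + 1 / (n + 1)) on the period for all n, so the differences C - h n are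
   nonnegative and increase with n, as monotone convergence requires. *)
pose C := ln (g c + 1).
have eta0 n : (0 < n.+1%:R^-1 :> R)%R by rewrite invr_gt0.
have eta1 n : (n.+1%:R^-1 <= 1 :> R)%R by rewrite invf_le1 // ler1n.
have gpos n t : (0 < g t + n.+1%:R^-1)%R by rewrite ltr_wpDl.
pose h n t := ln (g t + n.+1%:R^-1).
have ch n : continuous (h n).
  move=> t; apply: (@continuous_fcomp _ _ _ (fun t => g t + n.+1%:R^-1)%R (@ln R)).
    by apply: continuousD; [exact: cg|exact: cst_continuous].
  exact: continuous_ln.
have cCh n : continuous (fun t => C - h n t)%R.
  by move=> t; apply: (@cvgB _ _ _ _ _ (fun=> C) (h n)); [exact: cvg_cst|exact: ch].
pose f n (t : R) : \bar R := (C - h n t)%:E.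
pose F (t : R) : \bar R := C%:E - lne (g t)%:E.
have fF t : f ^~ t @ \oo --> F t.
  rewrite /F /f; have [gt0|gt0] := eqVneq (g t) 0%R.
    rewrite gt0 le0_lneNy //=; apply/cvgeyPge => B.
    exists (Num.bound (expR (B - C))) => // n /= Bn; rewrite lee_fin /h gt0 add0r.
    rewrite lnV ?posrE // opprK -lerBlDl -ler_expR lnK ?posrE //.
    rewrite (le_trans (ltW (archi_boundP (expR_ge0 _)))) // ler_nat.
    by rewrite (leq_trans Bn).
  have {}gt0 : (0 < g t)%R by rewrite lt_def gt0 g0.
  rewrite lne_EFin // -EFinB; apply: cvg_EFin; first exact: nearW.
  apply: cvgB; first exact: cvg_cst.
  have -> : (fun n => h n t) = @ln R \o (fun n => g t + n.+1%:R^-1)%R by [].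
  apply: continuous_cvg; first exact: continuous_ln.
  rewrite -[X in _ --> X]addr0; apply: cvgD; first exact: cvg_cst.
  exact: cvg_harmonic.
have mD : measurable `[0%R, tau] by [].
have mf n : measurable_fun `[0%R, tau] (f n).
  apply/measurable_EFinP; apply: measurable_funTS.
  exact: continuous_measurable_fun.
have f0 n t : t \in `[0%R, tau] -> 0 <= f n t.
  move=> tD; rewrite lee_fin subr_ge0 ler_ln ?posrE // ?lerD ?cmax //.
  by rewrite (lt_le_trans (gpos 0%N c)) // lerD.
have fnd t : t \in `[0%R, tau] -> nondecreasing_seq (f ^~ t).
  move=> _ m n mn; rewrite lee_fin lerD2l lerN2 ler_ln ?posrE // lerD2l.
  by rewrite lef_pV2 ?posrE // ler_nat.
have limF : (fun t => limn (f ^~ t)) = F by apply/funext => t; apply/cvg_lim.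
have := @cvg_monotone_convergence _ _ _ mu _ mD f mf f0 fnd; rewrite limF => cvI.
have intf n : \int[mu]_(t in `[0%R, tau]) f n t <= ((C - ln A) * tau)%:E.
  have seg a b : cont_seg a b (fun t => C - h n t)%R by move=> t _; exact: cCh.
  have seg' a b : cont_seg a b (h n) by move=> t _; exact: ch.
  rewrite -(fineK (integrable_fin_num _ (Int_integrable (seg 0%R tau)))) //.
  rewrite lee_fin -[leLHS]/(Int 0 tau (fun t => C - h n t)%R) (IntB (@cont_seg_cst _ _ _ C) (seg' _ _)).
  rewrite Int_cst ?(ltW tau0) // subr0 mulrBl lerD2l lerN2.
  exact: ln_le_mean.
have IF : \int[mu]_(t in `[0%R, tau]) F t <= ((C - ln A) * tau)%:E.
  rewrite -(cvg_lim _ cvI) //; apply: lime_le; first by apply/cvg_ex; eexists; exact: cvI.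
  by apply: nearW => n; exact: intf.
have mF : measurable_fun `[0%R, tau] F.
  by apply: (emeasurable_fun_cvg f) => // t _; exact: fF.
have F0 t : t \in `[0%R, tau] -> 0 <= F t.
  move=> tD; rewrite -limF; apply: lime_ge; last by apply: nearW => n; exact: f0.
  by apply/cvg_ex; exists (F t); exact: fF.
have iF : mu.-integrable `[0%R, tau] F.
  apply/integrableP; split => //; under eq_integral => t do [rewrite inE => tD; rewrite gee0_abs ?F0 //].
  exact: le_lt_trans IF (ltry _).
have iC : mu.-integrable `[0%R, tau] (cst C%:E).
  exact: (Int_integrable (cont_seg_cst (a := 0%R) (b := tau) (c := C))).
have -> : \int[mu]_(t in `[0%R, tau]) lne (g t)%:E =
    \int[mu]_(t in `[0%R, tau]) (cst C%:E \- F) t.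
  apply: eq_integral => t _; rewrite /F /=; case: ifPn => _ //=.
  by congr (_%:E); ring.
rewrite integralB // integral_cst // [X in _ * X - _](lebesgue_measure_itv `[0%R, tau]) /= lte_fin tau0.
rewrite -[leLHS]/(lne A%:E) lne_EFin //.
have -> : tau%:E - 0%:E = tau%:E by rewrite sube0.
have IFfin : \int[mu]_(t in `[0%R, tau]) F t \is a fin_num by exact: integrable_fin_num.
move: IFfin IF; case: (\int[mu]_(x in `[0%R, tau]) F x) => [i| |] // _.
rewrite lee_fin [X in _ -> _ <= X](_ : _ = (tau^-1 * (C * tau - i))%:E) // lee_fin => Ii.
rewrite -ler_pdivrMl ?invr_gt0 // invrK mulrC.
by move: Ii; lra.
Unshelve. all: by end_near. Qed.

End CircleMean.

(** * Submean inequality on circles of the complex plane *)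

Section CircleMeanC.
Context {R : realType}.
Local Notation C := (Cplx R).
Implicit Types (E : C -> R) (a w : C).

Definition cis (t : R) : C := Complex (cos t) (sin t).

Lemma cmod_cis t : cmod (cis t) = 1.
Proof. by rewrite cmodE /= cos2Dsin2 sqrtr1. Qed.

Lemma cisD (s t : R) : cis (s + t) = cis s * cis t.
Proof. by apply: Cext; rewrite ?ReCM ?ImCM /ReC /ImC /= ?cosD ?sinD //; ring. Qed.

Lemma polar w : exists2 t : R, 0 <= t & w = toC (cmod w) * cis t.
Proof.
have [->|w0] := eqVneq w 0; first by exists 0; rewrite // cmod0 mul0r.
have c0 : 0 < cmod w by rewrite cmod_gt0.
pose x := ReC w / cmod w; pose y := ImC w / cmod w.
have xy : x ^+ 2 + y ^+ 2 = 1.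
  by rewrite !expr_div_n -mulrDl -cmod_sqr divff // gt_eqF // exprn_gt0.
have x1 : -1 <= x <= 1.
  by rewrite -ler_norml normrM normfV (gtr0_norm c0) ler_pdivrMr // mul1r ReC_le_cmod.
have sy : Num.sqrt (1 - x ^+ 2) = `|y| by rewrite -xy addrAC subrr add0r sqrtr_sqr.
have wE t : cos t = x -> sin t = y -> w = toC (cmod w) * cis t.
  move=> ct st; apply: Cext; rewrite ?ReCM ?ImCM ReC_toC ImC_toC /ReC /ImC /= ct st.
    by rewrite mul0r subr0 mulrC divfK // gt_eqF.
  by rewrite mul0r addr0 mulrC divfK // gt_eqF.
have [y0|y0] := leP 0 y.
  exists (acos x); first exact: acos_ge0.
  by apply: wE; rewrite ?acosK ?in_itv // sin_acos // sy ger0_norm.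
(* In the lower half-plane a full turn is added: the offset used by [lne_le_mean] must be
   nonnegative. *)
exists (- acos x + pi *+ 2).
  by have := acos_lepi x1; have := pi_gt0 R; rewrite mulr2n; lra.
apply: wE; first by rewrite cosD2pi cosN acosK ?in_itv.
by rewrite sinD2pi sinN sin_acos // sy ltr0_norm // opprK.
Qed.

(** In polar form w = r e^(i th), the rotates of w by N-th roots of unity are equidistant points of
    the circle with offset th, so the products are those of [lne_le_mean]. *)
Lemma submean_of_prod E a (r : R) : 0 < r ->
  (forall v, cmod (v - a) <= r -> 0 <= E v) ->
  (forall v, cmod (v - a) <= r -> {for v, continuous E}) ->
  (forall N, (0 < N)%N -> exists2 w, cmod w = r &
    E a ^+ N <= \prod_(k < N) E (a + cis (k%:R * (2 * pi / N%:R)) * w)) ->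
  (lne (E a)%:E <= ((2 * pi)^-1)%:E *
    \int[lebesgue_measure]_(t in `[0%R, (2 * pi)%R]) lne (E (circle_point a r t))%:E)%E.
Proof.
move=> r0 E0 cE H.
have cp t : circle_point a r t = a + toC r * cis t by [].
have cmod_cp t : cmod (circle_point a r t - a) <= r.
  by rewrite cp addrAC subrr add0r cmodM cmod_cis mulr1 cmod_toC gtr0_norm.
apply: (@lne_le_mean _ (fun t => E (circle_point a r t))).
- move=> t; apply: (continuous_fcomp (g := E)); last exact: cE.
  have ccis : {for t, continuous cis}.
    by apply: continuous_Complex; [exact: continuous_cos|exact: continuous_sin].
  apply/continuousCP => e e0.
  have er : 0 < e / r by rewrite divr_gt0.
  have := (continuousCP cis t).1 ccis _ er; apply: filterS => s.
  have -> : circle_point a r s - circle_point a r t = toC r * (cis s - cis t).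
    by rewrite !cp; ring.
  by rewrite cmodM cmod_toC gtr0_norm // ltr_pdivlMr // mulrC.
- move=> t; rewrite !cp /cis mulr_natl cosD2pi sinD2pi //.
- by move=> t; exact: E0.
- by apply: E0; rewrite subrr cmod0 ltW.
move=> N N0; have [w wr HN] := H N N0; have [th th0 wth] := polar w.
exists th => //; apply: le_trans HN _; rewrite le_eqVlt; apply/orP; left; apply/eqP.
apply: eq_bigr => k _; congr E; rewrite cp wth wr addrC cisD [in RHS]addrC; congr (_ + _).
by rewrite mulrCA [cis th * _]mulrC.
Qed.

End CircleMeanC.

(** * Second-order Taylor expansion of Kaehler potentials *)

Section RealNorm.
Context {R : realType} {V : normedModType (Cplx R)}.
Local Notation C := (Cplx R).
Implicit Types (v w z : V) (a : C).

(** Norms here take values in [R[i]]; this is the same number in R. On row vectors it is the sup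
    norm, tied to the Euclidean one by [sqnorm_le_rnorm]. *)
Definition rnorm v : R := ReC `|v|.

Lemma norm_rnorm v : `|v| = toC (rnorm v).
Proof.
have pos (x : C) : 0 <= x -> x = toC (ReC x).
  by move=> /ger0_Im x0; apply: Cext.
exact/pos/normr_ge0.
Qed.
Lemma rnorm_ge0 v : 0 <= rnorm v.
Proof. by rewrite -toC_le toC0 -norm_rnorm normr_ge0. Qed.
Lemma rnormD v w : rnorm (v + w) <= rnorm v + rnorm w.
Proof. by rewrite -toC_le toCD -!norm_rnorm ler_normD. Qed.
Lemma rnormN v : rnorm (- v) = rnorm v.
Proof. by apply: toC_inj; rewrite -!norm_rnorm normrN. Qed.
Lemma rnormZ a v : rnorm (a *: v) = cmod a * rnorm v.
Proof. by apply: toC_inj; rewrite toCM -!norm_rnorm normrZ normC_cmod. Qed.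

Lemma near_rnormP (P : V -> Prop) z :
  (\forall w \near z, P w) <-> exists2 d : R, 0 < d & forall w, rnorm (w - z) < d -> P w.
Proof.
split=> [/nbhs_ballP[e /= e0 eP]|[d d0 dP]].
  have [e' ee'] : exists e', e = toC e'.
    by case: e e0 {eP} => a b; rewrite ltcE /= => /andP[/eqP -> _]; exists a.
  exists e'; first by rewrite -toC_lt -ee'.
  move=> w wz; apply: eP; rewrite -ball_normE /= ee' norm_rnorm toC_lt.
  by rewrite -rnormN opprB.
apply/nbhs_ballP; exists (toC d) => /=; first by rewrite -toC0 toC_lt.
by move=> w; rewrite -ball_normE /= norm_rnorm toC_lt -rnormN opprB; exact: dP.
Qed.

Lemma continuous_rnormP (f : V -> R) z : {for z, continuous f} <->
  forall e : R, 0 < e -> exists2 d : R, 0 < d &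
    forall w, rnorm (w - z) < d -> `|f w - f z| < e.
Proof.
split=> [/cvgrPdist_lt H e /H /near_rnormP[d d0 D]|H].
  by exists d => // w /D; rewrite distrC.
have Fz : Filter (nbhs z) by exact: nbhs_filter.
apply: (iffRL (@cvgrPdist_lt _ _ _ (nbhs z) Fz f (f z))) => e /H[d d0 D].
by apply/near_rnormP; exists d => // w /D; rewrite distrC.
Qed.

End RealNorm.

Section Taylor.
Context {R : realType} {n : nat}.
Local Notation C := (Cplx R).
Local Notation V := 'rV[C]_n.
Implicit Types (u : V -> R) (v w z : V) (U : set V).

Lemma cmod_coord_le v j : cmod (v 0 j) <= rnorm v.
Proof.
apply/ler_addgt0Pr => e e0.
have : ball (0 : V) (toC (rnorm v + e)) v.
  rewrite -ball_normE /= sub0r normrN norm_rnorm toC_lt.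
  by rewrite ltrDl.
move=> [_ /(_ 0 j)]; rewrite -ball_normE /= mxE sub0r normrN normC_cmod toC_lt.
exact: ltW.
Qed.

(** [smooth_on] speaks only of iterated directional derivatives. Their linearity in the direction is
    not built in; it is derived from this notion in [dir_derivZ] and [dir_derivD]. *)
Definition C1_on U u := forall v,
  (forall z, U z -> derivable (line u z v) 0 1) /\
  (forall z, U z -> {for z, continuous (dir_deriv v u)}).

Lemma line_shift u z v (s h : R) : line u (z + toC s *: v) v h = line u z v (s + h).
Proof. by rewrite /line toCD scalerDl addrA. Qed.

Lemma lineZ u z v (c : R) : line u z (toC c *: v) = line u z v \o ( *%R c).
Proof. by apply/funext => t; rewrite /line /= scalerA -toCM mulrC. Qed.

Lemma is_derive_line0 U u z v : C1_on U u -> U z ->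
  is_derive (0 : R) 1 (line u z v) (dir_deriv v u z).
Proof.
move=> u1 Uz; rewrite /dir_deriv derive1E; apply: derivableP.
exact: (u1 v).1.
Qed.

Lemma is_derive_line U u z v (s : R) : C1_on U u -> U (z + toC s *: v) ->
  is_derive s 1 (line u z v) (dir_deriv v u (z + toC s *: v)).
Proof.
move=> u1 Us.
have -> : line u z v = line u (z + toC s *: v) v \o (fun t => t - s).
  by apply/funext => t; rewrite /= line_shift addrC subrK.
rewrite -[dir_deriv _ _ _]mulr1; apply: is_derive1_comp.
  by rewrite subrr; exact: is_derive_line0 u1 Us.
have -> : (fun t => t - s) = id - cst s :> (R -> R) by [].
by apply: is_derive_eq; rewrite subr0.
Qed.

Lemma dir_derivZ U u z v (c : R) : C1_on U u -> U z ->
  dir_deriv (toC c *: v) u z = c * dir_deriv v u z.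
Proof.
move=> u1 Uz; rewrite {1}/dir_deriv derive1E lineZ.
have d0 : is_derive (c * 0 : R) 1 (line u z v) (dir_deriv v u z).
  by rewrite mulr0; exact: is_derive_line0 u1 Uz.
have d1 : is_derive (0 : R) 1 ( *%R c) c by apply: is_derive_eq; rewrite [LHS]mulr1.
have := is_derive1_comp (f := line u z v) (g := *%R c) (x := 0) => /(_ _ _ d0 d1) d2.
by rewrite derive_val mulrC.
Qed.

Lemma dir_deriv_mvt U u z v : C1_on U u ->
  (forall s : R, 0 <= s <= 1 -> U (z + toC s *: v)) ->
  exists2 th : R, 0 <= th <= 1 & u (z + v) - u z = dir_deriv v u (z + toC th *: v).
Proof.
move=> u1 HU.
have [||th] := @MVT_segment R (line u z v)
    (fun s => dir_deriv v u (z + toC s *: v)) 0 1 ler01.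
- move=> x; rewrite in_itv /= => /andP[x0 x1].
  by apply: (is_derive_line u1); apply: HU; rewrite !ltW.
- apply: derivable_within_continuous => x; rewrite in_itv /= => xs.
  by have := is_derive_line u1 (HU x xs) => /@ex_derive; apply.
rewrite in_itv /= => ths; rewrite subr0 mulr1 /line toC1 toC0 scale1r scale0r addr0.
by exists th.
Qed.

Lemma ball_segment z v w (r s : R) : rnorm (v - z) < r -> rnorm (v + w - z) < r ->
  0 <= s <= 1 -> rnorm (v + toC s *: w - z) < r.
Proof.
move=> h1 h2 /andP[s0 s1].
have -> : v + toC s *: w - z = toC (1 - s) *: (v - z) + toC s *: (v + w - z).
  by rewrite [v + w - z]addrAC [toC s *: (_ + _)]scalerDr addrA -scalerDl -toCD subrK toC1 scale1r addrAC.
apply: le_lt_trans (rnormD _ _) _; rewrite !rnormZ !cmod_toC !ger0_norm ?subr_ge0 //.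
have [->|sn0] := eqVneq s 0; first by rewrite subr0 mul1r mul0r addr0.
have sp : 0 < s by rewrite lt_def sn0.
have p1 : s * rnorm (v + w - z) < s * r by rewrite ltr_pM2l.
have p2 : (1 - s) * rnorm (v - z) <= (1 - s) * r by rewrite ler_wpM2l ?subr_ge0 // ltW.
by move: p1 p2; lra.
Qed.

(** The increment along t(v + w) is split at z + tv. By the mean value theorem its second half is t
    times the derivative along w at a nearby point, and that derivative is continuous at z. *)
Lemma dir_derivD U u z v w : open U -> C1_on U u -> U z ->
  dir_deriv (v + w) u z = dir_deriv v u z + dir_deriv w u z.
Proof.
move=> oU u1 Uz; apply/eqP; rewrite -subr_eq0 -normr_le0; apply/ler_addgt0Pr => e e0.
rewrite add0r; pose e3 := e / 3; have e30 : 0 < e3 by rewrite divr_gt0.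
have [r1 r10 H1] := is_derive_approx (is_derive_line0 (v + w) u1 Uz) e30.
have [r2 r20 H2] := is_derive_approx (is_derive_line0 v u1 Uz) e30.
have [r3 r30 H3] := (continuous_rnormP _ z).1 ((u1 w).2 z Uz) e3 e30.
have [r4 r40 H4] := (near_rnormP U z).1 (open_nbhs_nbhs (conj oU Uz)).
pose r := Num.min r3 r4; have r0 : 0 < r by rewrite lt_min r30 r40.
pose D := rnorm v + rnorm w + 1.
have D0 : 0 < D by rewrite ltr_wpDl // addr_ge0 ?rnorm_ge0.
pose t := Num.min (Num.min r1 r2) (r / D) / 2.
have m0 : 0 < Num.min (Num.min r1 r2) (r / D) by rewrite !lt_min r10 r20 divr_gt0.
have t0 : 0 < t by rewrite divr_gt0.
have : t < Num.min (Num.min r1 r2) (r / D) by rewrite gtr_pMr // invf_lt1 // ltr1n.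
rewrite !lt_min ltr_pdivlMr // => /andP[/andP[t1 t2] t3].
have nt : `|t| = t by rewrite gtr0_norm.
have := H1 t; rewrite nt add0r => /(_ t1) {}H1.
have := H2 t; rewrite nt add0r => /(_ t2) {}H2.
have vr : rnorm (z + toC t *: v - z) < r.
  rewrite addrAC subrr add0r rnormZ cmod_toC nt.
  by rewrite (le_lt_trans _ t3) // ler_pM2l // /D -addrA lerDl addr_ge0 ?rnorm_ge0.
have vwr : rnorm (z + toC t *: v + toC t *: w - z) < r.
  rewrite -(addrA z) addrAC subrr add0r (le_lt_trans (rnormD _ _)) // !rnormZ cmod_toC nt.
  by rewrite -mulrDr (le_lt_trans _ t3) // ler_pM2l // /D lerDl.
have seg s : 0 <= s <= 1 -> rnorm (z + toC t *: v + toC s *: (toC t *: w) - z) < r.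
  exact: ball_segment.
have rr34 x : x < r -> x < r3 /\ x < r4 by rewrite lt_min => /andP[].
have [th ths] := @dir_deriv_mvt U u (z + toC t *: v) (toC t *: w) u1
  (fun s hs => H4 _ (rr34 _ (seg s hs)).2).
have Uth := H4 _ (rr34 _ (seg th ths)).2.
rewrite (dir_derivZ _ _ u1 Uth).
have := H3 _ (rr34 _ (seg th ths)).1; set Dw := dir_deriv w u _ => Dw3 E.
move: H1 H2; rewrite /line toC0 !scale0r !addr0 scalerDr addrA => H1 H2.
set d0 := dir_deriv (v + w) u z in H1 *; set d1 := dir_deriv v u z in H2 *.
set d2 := dir_deriv w u z in Dw3 *.
rewrite -(ler_pM2r t0) -{1}nt -normrM.
have -> : (d0 - (d1 + d2)) * t = - (u (z + toC t *: v + toC t *: w) - u z - d0 * t) +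
  (u (z + toC t *: v) - u z - d1 * t) + t * (Dw - d2).
  by rewrite mulrBr -E; ring.
rewrite (le_trans (ler_normD _ _)) // (le_trans (lerD (ler_normD _ _) (lexx _))) //.
rewrite normrN [`|t * _|]normrM nt.
have := ltW Dw3; rewrite -(ler_pM2l t0) => Dw4.
have ee : e = e3 * 3 by rewrite /e3 divfK.
by move: H1 H2 Dw4; rewrite ee; clear; lra.
Qed.

Lemma dir_deriv_near u1 u2 z v : (\forall w \near z, u1 w = u2 w) ->
  dir_deriv v u1 z = dir_deriv v u2 z.
Proof.
move=> /near_rnormP[r r0 H]; rewrite /dir_deriv !derive1E; apply: near_eq_derive.
have D0 : 0 < rnorm v + 1 by rewrite ltr_wpDl ?rnorm_ge0.
have d0 : 0 < r / (rnorm v + 1) by rewrite divr_gt0.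
apply/nbhs_ballP; exists (r / (rnorm v + 1)) => //= t; rewrite /ball /= sub0r normrN => tr.
apply: H; rewrite addrAC subrr add0r rnormZ cmod_toC.
move: tr; rewrite ltr_pdivlMr // => tr.
by rewrite (le_lt_trans _ tr) // ler_wpM2l // lerDl.
Qed.

Lemma derive1_add (f g : R -> R) (x : R) : derivable f x 1 -> derivable g x 1 ->
  derive1 (fun t => f t + g t) x = derive1 f x + derive1 g x.
Proof. by move=> df dg; rewrite !derive1E -(deriveD df dg). Qed.

Lemma derive1_scale (f : R -> R) (x c : R) : derivable f x 1 ->
  derive1 (fun t => c * f t) x = c * derive1 f x.
Proof. by move=> df; rewrite !derive1E -[RHS](deriveZ c df). Qed.

Lemma dir_deriv_add u1 u2 z v : derivable (line u1 z v) 0 1 ->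
  derivable (line u2 z v) 0 1 ->
  dir_deriv v (fun w => u1 w + u2 w) z = dir_deriv v u1 z + dir_deriv v u2 z.
Proof. exact: derive1_add. Qed.

Lemma dir_deriv_scale u z v (c : R) : derivable (line u z v) 0 1 ->
  dir_deriv v (fun w => c * u w) z = c * dir_deriv v u z.
Proof. exact: derive1_scale. Qed.

(** Real coordinates of v in the basis [frame] of C^n over R; the boolean tells the direction i e_j
    from e_j. *)
Definition coef v (a : 'I_n * bool) : R := if a.2 then ImC (v 0 a.1) else ReC (v 0 a.1).
Definition frame (a : 'I_n * bool) : V :=
  if a.2 then IC *: unit_vec a.1 else unit_vec a.1.

Lemma sum_frame (K : nmodType) (f : 'I_n * bool -> K) :
  \sum_a f a = \sum_j (f (j, false) + f (j, true)).
Proof.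
have -> : \sum_a f a = \sum_a f (a.1, a.2) by apply: eq_bigr => -[].
rewrite -(pair_bigA _ (fun j b => f (j, b))) /=; apply: eq_bigr => j _.
by rewrite big_bool addrC.
Qed.

Lemma frame_expansion v : v = \sum_a toC (coef v a) *: frame a.
Proof.
rewrite sum_frame; apply/matrixP => i k; rewrite (ord1 i) summxE.
rewrite (bigD1 k) //= big1 ?addr0 => [|j jk]; rewrite /coef /frame !mxE /= ?eqxx.

  rewrite !mulr1; apply: Cext; rewrite ?(ReCD, ImCD, ReCM, ImCM) /ReC /ImC /=; ring.
by rewrite eq_sym (negbTE jk) !mulr0 addr0.
Qed.

Lemma coef_le v a : `|coef v a| <= rnorm v.
Proof.
rewrite /coef; case: ifP => _; apply: le_trans (cmod_coord_le v a.1).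
  exact: ImC_le_cmod.
exact: ReC_le_cmod.
Qed.

Lemma real_linear_frame (f : V -> R) : (forall v w, f (v + w) = f v + f w) ->
  (forall c v, f (toC c *: v) = c * f v) ->
  forall v, f v = \sum_a coef v a * f (frame a).
Proof.
move=> fD fZ v; rewrite {1}(frame_expansion v).
have f0 : f 0 = 0 by have := fZ 0 0; rewrite scaler0 mul0r.
by rewrite (big_morph f fD f0); apply: eq_bigr => a _; rewrite fZ.
Qed.

Definition C2_on U u := C1_on U u /\ forall v, C1_on U (dir_deriv v u).

Lemma smooth_C2 U u : smooth_on U u -> C2_on U u.
Proof.
move=> /(_ 2%N) [_ H]; split=> v; first split.
- by move=> z Uz; exact: (H v).1.
- by move=> z Uz; exact: (H v).2.1.
move=> w; split=> z Uz; first by exact: ((H v).2.2 w).1.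
by case: ((H v).2.2 w).2 => + _; exact.
Qed.

Definition hess u z v w := dir_deriv v (dir_deriv w u) z.

(** Finitely many entries determine the Hessian, so continuity of each of them gives an estimate
    uniform in v. Linearity in w needs the first-order identity on a whole neighbourhood before it
    can be differentiated. *)
Lemma hess_frame U u z v w : open U -> C2_on U u -> U z ->
  hess u z v w = \sum_a \sum_b coef v a * coef w b * hess u z (frame a) (frame b).
Proof.
move=> oU [u1 u2] Uz.
rewrite (real_linear_frame (f := fun v => hess u z v w)).
- apply: eq_bigr => a _.
  rewrite (real_linear_frame (f := fun w => hess u z (frame a) w)).
  + by rewrite mulr_sumr; apply: eq_bigr => b _; rewrite mulrA.
  + move=> w1 w2; apply: etrans (dir_deriv_add ((u2 w1 (frame a)).1 z Uz) ((u2 w2 (frame a)).1 z Uz)).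
    apply: dir_deriv_near.
    apply: filterS (open_nbhs_nbhs (conj oU Uz)) => y Uy.
    exact: (dir_derivD _ _ oU u1 Uy).
  + move=> c w1; apply: etrans (dir_deriv_scale c ((u2 w1 (frame a)).1 z Uz)).
    apply: dir_deriv_near.
    apply: filterS (open_nbhs_nbhs (conj oU Uz)) => y Uy.
    exact: (dir_derivZ _ _ u1 Uy).
- by move=> v1 v2; exact: (dir_derivD _ _ oU (u2 w) Uz).
- by move=> c v1; exact: (dir_derivZ _ _ (u2 w) Uz).
Qed.

Lemma taylor_aux (f : R -> R) (x d D B : R) : is_derive x 1 f d ->
  is_derive x 1 (fun t => f t - D * t - B / 2 * t ^+ 2) (d - D - B * x).
Proof.
move=> fd.
have -> : (fun t => f t - D * t - B / 2 * t ^+ 2) = f - D *: id - (B / 2) *: (id ^+ 2) by [].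
by apply: is_derive_eq; rewrite /GRing.scale /=; field.
Qed.

(** Two mean value steps: one for u minus its quadratic polynomial along the segment, one for the
    derivative along v. The remainder is th times a difference of Hessians at nearby points, with 0
    <= th <= 1. *)
Lemma taylor2 U u z : open U -> C2_on U u -> U z -> forall e : R, 0 < e ->
  exists2 r : R, 0 < r & forall v, rnorm v < r ->
    `|u (z + v) - u z - dir_deriv v u z - hess u z v v / 2| <= e * rnorm v ^+ 2.
Proof.
move=> oU u12 Uz e e0; have [u1 u2] := u12.
(* The number of Hessian entries, over which e is distributed; the added 1 keeps it positive when n
   = 0. *)
pose N : R := #|{: ('I_n * bool) * ('I_n * bool)}|%:R + 1.
have N0 : 0 < N by rewrite ltr_wpDl.
have eN : 0 < e / N by rewrite divr_gt0.
have : \forall y \near z, forall ab : ('I_n * bool) * ('I_n * bool),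
    `|hess u z (frame ab.1) (frame ab.2) - hess u y (frame ab.1) (frame ab.2)| < e / N.
  apply: (@filter_forall _ _ (fun ab y => `|hess u z (frame ab.1) (frame ab.2) -
    hess u y (frame ab.1) (frame ab.2)| < e / N) (nbhs z)) => -[a b] /=.
  by have /cvgrPdist_lt/(_ _ eN) := (u2 (frame b) (frame a)).2 z Uz.
move=> /near_rnormP[r1 r10 H1].
have [r2 r20 H2] := (near_rnormP U z).1 (open_nbhs_nbhs (conj oU Uz)).
exists (Num.min r1 r2); first by rewrite lt_min r10 r20.
move=> v vr.
have seg s : 0 <= s <= 1 -> rnorm (z + toC s *: v - z) < Num.min r1 r2.
  move=> /andP[s0 s1]; rewrite addrAC subrr add0r rnormZ cmod_toC ger0_norm //.
  by rewrite (le_lt_trans _ vr) // ler_piMl ?rnorm_ge0.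
have sU s : 0 <= s <= 1 -> U (z + toC s *: v).
  by move=> /seg; rewrite lt_min => /andP[_ /H2].
have close s : 0 <= s <= 1 -> `|hess u (z + toC s *: v) v v - hess u z v v| <= e * rnorm v ^+ 2.
  move=> ss; rewrite (hess_frame v v oU u12 (sU s ss)) (hess_frame v v oU u12 Uz).
  have hs : rnorm (z + toC s *: v - z) < r1 by have := seg s ss; rewrite lt_min => /andP[].
  rewrite -sumrB (le_trans (ler_norm_sum _ _ _)) //.
  apply: (@le_trans _ _ (\sum_(a : 'I_n * bool) \sum_(b : 'I_n * bool) e / N * rnorm v ^+ 2)).
    apply: ler_sum => a _; rewrite -sumrB (le_trans (ler_norm_sum _ _ _)) //.
    apply: ler_sum => b _; move: (H1 _ hs (a, b)) => /=.
    move: (hess u z _ _) (hess u (z + _) _ _) => h1 h2; rewrite distrC => /ltW h.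
    rewrite -mulrBr normrM [leLHS]mulrC ler_pM // normrM expr2.
    by rewrite ler_pM // coef_le.
  rewrite pair_bigA /= sumr_const -mulr_natl mulrA ler_wpM2r ?sqr_ge0 //.
  rewrite mulrCA ler_piMr ?(ltW e0) // ler_pdivrMr // mul1r /N cardE lerDl //.
set D := dir_deriv v u z; set B := hess u z v v.
have [||th] := @MVT_segment R (fun t => line u z v t - D * t - B / 2 * t ^+ 2)
    (fun s => dir_deriv v u (z + toC s *: v) - D - B * s) 0 1 ler01.
- move=> x; rewrite in_itv /= => /andP[x0 x1].
  by apply: taylor_aux; apply: (is_derive_line u1); apply: sU; rewrite !ltW.
- apply: derivable_within_continuous => x; rewrite in_itv /= => xs.
  by have := taylor_aux D B (is_derive_line u1 (sU x xs)) => /@ex_derive; apply.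
rewrite in_itv /line toC1 toC0 scale1r scale0r addr0 => /= ths E.
have -> : u (z + v) - u z - D - B / 2 = dir_deriv v u (z + toC th *: v) - D - B * th.
  move: E; move: (dir_deriv v u _) D B (u (z + v)) (u z) => X D B y1 y0 E.
  have -> : X - D - B * th = (X - D - B * th) * (1 - 0) by rewrite subr0 mulr1.
  by rewrite -E; ring.
have sV s : 0 <= s <= 1 -> U (z + toC s *: (toC th *: v)).
  move=> /andP[s0 s1]; rewrite scalerA -toCM; apply: sU.
  by move: ths => /andP[? ?]; rewrite mulr_ge0 //= mulr_ile1.
have [ph phs] := dir_deriv_mvt (u2 v) sV.
rewrite (dir_derivZ _ _ (u2 v) (sV _ phs)) -/(hess _ _ _ _) -/D => ->.
have -> (h : R) : th * h - B * th = th * (h - B) by ring.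
have th01 : 0 <= th <= 1 by [].
move: ths => /andP[th0 th1].
rewrite normrM ger0_norm // (le_trans (ler_piMl _ th1)) //.
rewrite scalerA -toCM; apply: close; move: phs => /andP[? ?].
by rewrite mulr_ge0 //= mulr_ile1.
Qed.

Lemma toC2V : (2^-1 : C) = toC 2^-1.
Proof.
apply: (mulfI (_ : (2 : C) != 0)); rewrite ?pnatr_eq0 // divff ?pnatr_eq0 //.
by apply: Cext; rewrite /ReC /ImC /=; field.
Qed.

Lemma half_add_i (a b : R) : toC 2^-1 * (Complex a 0 + IC * Complex b 0) =
  Complex (2^-1 * a) (2^-1 * b) :> C.
Proof. by apply: Cext; rewrite ?(ReCM, ImCM, ReCD, ImCD) /ReC /ImC /=; ring. Qed.

Lemma half_sub_i (a b c d x y p q : R) :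
  x = 2^-1 * a -> y = 2^-1 * b -> p = 2^-1 * c -> q = 2^-1 * d ->
  toC 2^-1 * (Complex x y - IC * Complex p q) = toC 4^-1 * Complex (a + d) (b - c) :> C.
Proof. by move=> -> -> -> ->; apply: Cext; rewrite ?(ReCM, ImCM, ReCB, ImCB) /ReC /ImC /=; field. Qed.

Lemma ddc_hess U u z j k : open U -> C2_on U u -> U z ->
  ddc u z j k = IC / toC (2 * pi) * toC 4^-1 *
   (Complex (hess u z (frame (j, false)) (frame (k, false)) +
             hess u z (frame (j, true)) (frame (k, true)))
            (hess u z (frame (j, false)) (frame (k, true)) -
             hess u z (frame (j, true)) (frame (k, false)))).
Proof.
move=> oU [u1 u2] Uz; rewrite mxE -[RHS]mulrA; congr (_ * _).
have zb : d_zbar k (toC \o u) = fun y => Complex (2^-1 * dir_deriv (frame (k, false)) u y)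
    (2^-1 * dir_deriv (frame (k, true)) u y).
  apply/funext => y; rewrite /d_zbar toC2V /dir_derivC.
  have z0 v : dir_deriv v (@ImC R \o (@toC R \o u)) y = 0.
    by apply: (@dir_deriv_quadratic _ _ _ _ _ 0 _ 0) => t; rewrite /line /=; ring.
  rewrite !z0; exact: half_add_i.
have half v (c : 'I_n * bool) :
    dir_deriv v (fun y => 2^-1 * dir_deriv (frame c) u y) z = 2^-1 * hess u z v (frame c).
  exact: (dir_deriv_scale _ ((u2 (frame c) v).1 z Uz)).
rewrite /d_z zb toC2V; apply: half_sub_i; exact: half.
Qed.

(** Multiplication by -i (2 pi) 4 clears the constant in front of a + ib and turns i / 2 into 4
    pi. *)
Lemma std_coef (a b : R) (d : bool) :
  IC / 2 *+ d = IC / toC (2 * pi) * toC 4^-1 * Complex a b :> C ->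
  a = 4 * pi * d%:R /\ b = 0.
Proof.
move=> H; have p0 : (pi : R) != 0 by rewrite gt_eqF // pi_gt0.
have ic : IC * - IC = 1 :> C.
  by apply: Cext; rewrite ?(ReCM, ImCM, ReCN, ImCN) /ReC /ImC /=; ring.
have tp : toC (2 * pi) != 0 :> C.
  by apply/eqP => /toC_inj/eqP; apply/negP; rewrite mulf_neq0 // pnatr_eq0.
have H2 : Complex a b = toC (4 * pi * d%:R).
  have -> : (Complex a b : C) =
      - IC * (toC (2 * pi) * toC 4) * (IC / toC (2 * pi) * toC 4^-1 * Complex a b).
    set w : C := Complex a b; set t := toC (2 * pi) in tp *.
    transitivity (((IC : C) * - IC) * (t / t) * (toC 4^-1 * toC 4) * w); last by ring.
    by rewrite ic divff // -toCM mulVf ?pnatr_eq0 // !mul1r.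
  rewrite -H; case: d {H}; last by rewrite mulr0n !mulr0.
  rewrite mulr1n toC2V mulr1 -toCM.
  transitivity (((IC : C) * - IC) * (toC (2 * pi * 4) * toC 2^-1)); first by ring.
  by rewrite ic mul1r -toCM; congr toC; field.
have := congr1 (@ReC R) H2; have := congr1 (@ImC R) H2.
by rewrite /ReC /ImC /= => -> ->.
Qed.

Lemma hess_std U u z j k : open U -> C2_on U u -> U z -> ddc u z = std_kahler z ->
  hess u z (frame (j, false)) (frame (k, false)) +
  hess u z (frame (j, true)) (frame (k, true)) = 4 * pi * (j == k)%:R /\
  hess u z (frame (j, false)) (frame (k, true)) =
  hess u z (frame (j, true)) (frame (k, false)).
Proof.
move=> oU u12 Uz E.
have H : IC / 2 *+ (j == k) = ddc u z j k by rewrite E std_kahlerE mxE.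
have [h1 h2] := std_coef (etrans H (ddc_hess j k oU u12 Uz)).
by split; [exact: h1|exact: subr0_eq h2].
Qed.

Lemma sum_diag (c : R) (g : 'I_n -> 'I_n -> R) :
  \sum_j \sum_k (c * (j == k)%:R * g j k) = c * \sum_j g j j.
Proof.
rewrite mulr_sumr; apply: eq_bigr => j _; rewrite (bigD1 j) //= big1.
  by rewrite addr0 eqxx mulr1.
by move=> k kj; rewrite eq_sym (negbTE kj) mulr0 mul0r.
Qed.

Lemma sqnorm_diag (c : R) v : c * sqnorm v = \sum_j \sum_k (c * (j == k)%:R *
      (ReC (v 0 j) * ReC (v 0 k) + ImC (v 0 j) * ImC (v 0 k))).
Proof. by rewrite sum_diag. Qed.

Lemma quad_split (b1 b2 b3 b4 d : R) (x y : C) : b1 + b4 = 4 * pi * d -> b2 = b3 ->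
  (ReC x * ReC y * b1 + ReC x * ImC y * b2 + (ImC x * ReC y * b3 + ImC x * ImC y * b4)) / 2 =
  ReC (toC 4^-1 * Complex (b1 - b4) (- (b2 + b3)) * x * y) +
  pi * d * (ReC x * ReC y + ImC x * ImC y).
Proof.
move=> h ->; have -> : pi * d = (b1 + b4) / 4 by rewrite h; field.
by case: x y => x y [p q]; rewrite !ReCM !ImCM /ReC /ImC /=; field.
Qed.

(** A real quadratic form is the real part of a holomorphic one plus a Hermitian form. The
    hypotheses say that the Hermitian part, the Levi form, is pi|v|^2. *)
Lemma quad_form_split (B : 'I_n * bool -> 'I_n * bool -> R) v :
  (forall j k, B (j, false) (k, false) + B (j, true) (k, true) = 4 * pi * (j == k)%:R) ->
  (forall j k, B (j, false) (k, true) = B (j, true) (k, false)) ->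
  (\sum_a \sum_b coef v a * coef v b * B a b) / 2 =
  ReC (\sum_j \sum_k toC 4^-1 *
    Complex (B (j, false) (k, false) - B (j, true) (k, true))
            (- (B (j, false) (k, true) + B (j, true) (k, false))) * v 0 j * v 0 k) +
  pi * sqnorm v.
Proof.
move=> h1 h2; rewrite sqnorm_diag sum_frame ReC_sum -big_split mulr_suml.
apply: eq_bigr => j _; rewrite !sum_frame -big_split ReC_sum -big_split mulr_suml.
by apply: eq_bigr => k _; exact: (quad_split _ _ (h1 j k) (h2 j k)).
Qed.

(** The condition on [ddc u] fixes the Hermitian part of the second-order term; all the rest of the
    Taylor polynomial beyond the constant is the real part of a holomorphic polynomial. *)
Lemma taylor_kahler U u z : open U -> smooth_on U u -> U z -> ddc u z = std_kahler z ->
  exists (l : 'I_n -> C) (S : 'I_n -> 'I_n -> C), forall e : R, 0 < e ->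
  exists2 r : R, 0 < r & forall v, rnorm v < r ->
    `|u (z + v) - u z - ReC (\sum_j l j * v 0 j + \sum_j \sum_k S j k * v 0 j * v 0 k)
      - pi * sqnorm v| <= e * rnorm v ^+ 2.
Proof.
move=> oU /smooth_C2 u12 Uz E; have u1 := u12.1.
pose b j s k t := hess u z (frame (j, s)) (frame (k, t)).
(* In complex notation, l_j = 2 du/dz_j and S_jk = d^2 u / dz_j dz_k. *)
pose l j : C := Complex (dir_deriv (frame (j, false)) u z) (- dir_deriv (frame (j, true)) u z).
pose S j k : C := toC 4^-1 * Complex (b j false k false - b j true k true)
  (- (b j false k true + b j true k false)).
exists l, S => e e0; have [r r0 H] := taylor2 oU u12 Uz e0.
exists r; first exact: r0.
move=> v vr; move: (H v vr) => {H}.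
have lin : dir_deriv v u z = ReC (\sum_j l j * v 0 j).
  apply: etrans (real_linear_frame (f := fun v => dir_deriv v u z) _ _ v) _.
  - by move=> v1 v2; exact: (dir_derivD _ _ oU u1 Uz).
  - by move=> c v1; exact: (dir_derivZ _ _ u1 Uz).
  rewrite sum_frame ReC_sum; apply: eq_bigr => j _; rewrite ReCM /coef /=.
  rewrite /l; move: (dir_deriv _ _ _) (dir_deriv _ _ _) (v 0 j) => d1 d2 x.
  by rewrite /ReC /ImC /=; ring.
have quad : hess u z v v / 2 = ReC (\sum_j \sum_k S j k * v 0 j * v 0 k) + pi * sqnorm v.
  rewrite (hess_frame v v oU u12 Uz).
  apply: (quad_form_split (B := fun a c => hess u z (frame a) (frame c))) => j k.
    exact: (hess_std j k oU u12 Uz E).1.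
  exact: (hess_std j k oU u12 Uz E).2.
have split4 (A d h x y p : R) : d = x -> h = y + p -> A - d - h = A - (x + y) - p.
  by move=> -> ->; ring.
by rewrite (split4 _ _ _ _ _ _ lin quad) ReCD.
Qed.

End Taylor.

(** * Suprema of Gaussian-weighted translates *)

Section VectorRules.
Context {K : numFieldType} {V : normedModType K}.

Lemma differentiable_line (z v : V) (w : K) : differentiable (fun w : K => z + w *: v) w.
Proof.
apply: differentiable_cst_add.
have d := @is_diff_scalel K V w v; exact: ex_diff.
Qed.

Lemma differentiable_translate (W : normedModType K) (f : V -> W) (a z : V) :
  differentiable f (z + a) -> differentiable (fun z => f (z + a)) z.
Proof.
move=> df; exact: (differentiable_fcomp (g := f)).
Qed.

Lemma differentiable_coord_comp n (g : K -> 'rV[K]_n) (j : 'I_n) w :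
  differentiable g w -> differentiable (fun w => g w 0 j) w.
Proof.
move=> dg; apply: (differentiable_fcomp (g := fun M : 'rV[K]_n => M 0 j)) => //.
exact: differentiable_coord.
Qed.

End VectorRules.

Section Sqnorm.
Context {R : realType} {n : nat}.
Local Notation C := (Cplx R).
Local Notation V := 'rV[C]_n.
Implicit Types (v w z : V).

(** The conjugate falls on the second argument, so that [herm z lam] is holomorphic in z. *)
Definition herm v w : C := \sum_j v 0 j * conjc (w 0 j).

Lemma sqnorm_ge0 v : 0 <= sqnorm v.
Proof. by apply: sumr_ge0 => j _; rewrite addr_ge0 ?sqr_ge0. Qed.

Lemma sqnormD v w : sqnorm (v + w) = sqnorm v + 2 * ReC (herm v w) + sqnorm w.
Proof.
rewrite /sqnorm /herm ReC_sum mulr_sumr -!big_split /=; apply: eq_bigr => j _.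
rewrite mxE; case: (v 0 j) (w 0 j) => a b [c d].
by rewrite /ReC /ImC /=; ring.
Qed.

Lemma sqnormZ (a : C) v : sqnorm (a *: v) = cmod a ^+ 2 * sqnorm v.
Proof.
rewrite /sqnorm mulr_sumr; apply: eq_bigr => j _.
by rewrite mxE -!cmod_sqr cmodM exprMn.
Qed.

Lemma sqnorm_eq0 v : sqnorm v = 0 -> v = 0.
Proof.
move=> /eqP; rewrite psumr_eq0 => [/allP H|j _]; last by rewrite addr_ge0 ?sqr_ge0.
apply/matrixP => i j; rewrite (ord1 i) mxE.
have := H j; rewrite mem_index_enum => /(_ isT) /=; rewrite -cmod_sqr sqrf_eq0 cmod_eq0.
by move/eqP.
Qed.

Lemma sqnorm0 : sqnorm (0 : V) = 0.
Proof. by rewrite /sqnorm big1 // => j _; rewrite mxE /= expr0n addr0. Qed.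

Lemma sqnormD_le v w : sqnorm (v + w) <= 2 * sqnorm v + 2 * sqnorm w.
Proof.
rewrite /sqnorm !mulr_sumr -big_split /=; apply: ler_sum => j _.
rewrite mxE ReCD ImCD; move: (ReC _) (ReC _) (ImC _) (ImC _) => a b c d.
have := sqr_ge0 (a - b); have := sqr_ge0 (c - d); rewrite !sqrrD !sqrrN !mulrN; lra.
Qed.

Lemma sqnorm_le_rnorm v : sqnorm v <= n%:R * rnorm v ^+ 2.
Proof.
have -> : n%:R * rnorm v ^+ 2 = \sum_(j < n) rnorm v ^+ 2.
  by rewrite sumr_const card_ord mulr_natl.
apply: ler_sum => j _.
by rewrite -cmod_sqr ler_pXn2r ?nnegrE ?cmod_ge0 ?rnorm_ge0 // cmod_coord_le.
Qed.

Lemma near_sqnorm z (d : R) : 0 < d -> \forall w \near z, sqnorm (w - z) < d.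
Proof.
move=> d0; pose e := Num.sqrt (d / (n%:R + 1)).
have n1 : 0 < n%:R + 1 :> R by rewrite ltr_wpDl.
have e0 : 0 < e by rewrite sqrtr_gt0 divr_gt0.
apply/near_rnormP; exists e => // w we; apply: le_lt_trans (sqnorm_le_rnorm _) _.
have : rnorm (w - z) ^+ 2 < e ^+ 2 by rewrite ltr_pXn2r ?nnegrE ?rnorm_ge0 // ltW.
rewrite sqr_sqrtr ?divr_ge0 ?(ltW d0) ?(ltW n1) // ltr_pdivlMr // => h.
apply: le_lt_trans h; rewrite mulrC ler_wpM2l ?sqr_ge0 // lerDl //.
Qed.

Lemma continuous_sqnorm z : {for z, continuous (fun z => sqnorm z)}.
Proof.
apply: continuous_fsum => j.
have cj : {for z, continuous (fun z : V => z 0 j)}.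
  by apply: differentiable_continuous; exact: differentiable_coord.
have cR : {for z, continuous (fun z : V => ReC (z 0 j))}.
  by apply: (continuous_fcomp (g := @ReC R)) cj _; exact: continuous_ReC.
have cI : {for z, continuous (fun z : V => ImC (z 0 j))}.
  by apply: (continuous_fcomp (g := @ImC R)) cj _; exact: continuous_ImC.
exact: (continuous_add (continuous_mul cR cR) (continuous_mul cI cI)).
Qed.

End Sqnorm.

Section GaussianSup.
Context {R : realType} {n : nat}.
Local Notation C := (Cplx R).
Local Notation V := 'rV[C]_n.
Implicit Types (v w z lam : V).
Variables (F : V -> C) (S : set V).
Hypotheses (dF : forall z, differentiable F z)
  (F1 : forall z, cmod (F z) ^+ 2 * expR (- (pi * sqnorm z)) <= 1) (S0 : S 0).

(** The square root of the weighted |F|^2, since the Lipschitz estimates concern moduli and not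
    their squares. *)
Definition gauss z : R := cmod (F z) * expR (- (pi * sqnorm z / 2)).

Lemma gauss_sqr z : gauss z ^+ 2 = cmod (F z) ^+ 2 * expR (- (pi * sqnorm z)).
Proof.
by rewrite /gauss exprMn -expRM_natr; congr (_ * expR _); rewrite mulNr divfK.
Qed.

Lemma gauss_ge0 z : 0 <= gauss z.
Proof. by rewrite mulr_ge0 ?cmod_ge0 ?expR_ge0. Qed.

Lemma gauss_le1 z : gauss z <= 1.
Proof. by rewrite -(@ler_pXn2r _ 2%N) ?nnegrE ?gauss_ge0 // gauss_sqr expr1n. Qed.

Definition gauss_sup z : R := sup [set gauss (z + lam) | lam in S].

Let gauss_has_sup z : has_sup [set gauss (z + lam) | lam in S].
Proof.
split; first by exists (gauss (z + 0)), 0.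
by exists 1 => _ [lam _ <-]; exact: gauss_le1.
Qed.

Lemma gauss_le_sup z lam : S lam -> gauss (z + lam) <= gauss_sup z.
Proof.
move=> Sl; apply: ub_le_sup; last by exists lam.
by exists 1 => _ [l _ <-]; exact: gauss_le1.
Qed.

Lemma gauss_sup_le z c : (forall lam, S lam -> gauss (z + lam) <= c) -> gauss_sup z <= c.
Proof.
move=> H; apply: ge_sup; first by exists (gauss (z + 0)), 0.
by move=> _ [lam /H h <-].
Qed.

Lemma gauss_sup_gt z c : c < gauss_sup z -> exists2 lam, S lam & c < gauss (z + lam).
Proof. by move=> /(sup_gt (gauss_has_sup z).1)[_ [lam Sl <-] h]; exists lam. Qed.

Lemma gauss_sup_ge0 z : 0 <= gauss_sup z.
Proof. exact: le_trans (gauss_ge0 _) (gauss_le_sup z S0). Qed.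

(* The holomorphic function with modulus gauss (z + lam) * exp (pi |z|^2 / 2) *)
Definition twist lam z : C :=
  F (z + lam) * cexp (toC (- pi) * herm z lam + toC (- (pi * sqnorm lam / 2))).

Lemma cmod_twist lam z : cmod (twist lam z) = gauss (z + lam) * expR (pi * sqnorm z / 2).
Proof.
rewrite /twist /gauss cmodM cmod_cexp -[RHS]mulrA -expRD; congr (_ * expR _).
rewrite ReCD ReCM !ReC_toC ImC_toC mul0r subr0 sqnormD.
by move: (ReC _) => x; field.
Qed.

Lemma differentiable_twist lam z : differentiable (twist lam) z.
Proof.
apply: differentiable_mul; first exact: differentiable_translate (dF (z + lam)).
apply: (differentiable_fcomp (g := cexp)); last exact: differentiable_cexp.
apply: differentiable_add_cst; apply: differentiable_cst_mul.
apply: differentiable_fsum => j; apply: differentiable_mul; last exact: differentiable_cst.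
exact: differentiable_coord.
Qed.

(** Schwarz's lemma on the complex line through z along v / |v|. There |z + wu|^2 <= 2|z|^2 + 2, so
    the modulus is at most exp(pi(|z|^2 + 1)); the factor 2 comes from subtracting the value at z.
    The bound does not depend on [lam]. *)
Lemma twist_lipschitz lam z v : sqnorm v <= 1 ->
  cmod (twist lam (z + v) - twist lam z) <=
  2 * expR (pi * (sqnorm z + 1)) * Num.sqrt (sqnorm v).
Proof.
move=> v1; have [->|v0] := eqVneq v 0.
  by rewrite addr0 subrr cmod0 !mulr_ge0 ?expR_ge0 ?sqrtr_ge0.
pose s := Num.sqrt (sqnorm v).
have s0 : 0 < s.
  rewrite sqrtr_gt0 lt_def sqnorm_ge0 andbT; apply: contra_neq v0; exact: sqnorm_eq0.
have ss : s ^+ 2 = sqnorm v by rewrite sqr_sqrtr // sqnorm_ge0.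
have s1 : s <= 1 by rewrite -(@ler_pXn2r _ 2%N) ?nnegrE ?(ltW s0) // ss expr1n.
pose u := toC s^-1 *: v.
have su : toC s *: u = v by rewrite scalerA -toCM divff ?toC1 ?scale1r // gt_eqF.
have u1 : sqnorm u = 1.
  rewrite sqnormZ cmod_toC ger0_norm ?invr_ge0 ?(ltW s0) // -ss -exprMn mulVf ?expr1n //.
  by rewrite gt_eqF.
pose M := expR (pi * (sqnorm z + 1)).
pose h (w : C) := twist lam (z + w *: u).
have hM (w : C) : cmod w <= 1 -> cmod (h w) <= M.
  move=> w1; rewrite /h cmod_twist -[M]mul1r ler_pM ?gauss_ge0 ?expR_ge0 ?gauss_le1 //.
  rewrite ler_expR ler_pdivrMr // -mulrA ler_pM2l ?pi_gt0 //.
  have w2 : cmod w ^+ 2 <= 1 by rewrite expr_le1 // cmod_ge0.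
  rewrite (le_trans (sqnormD_le _ _)) // sqnormZ u1 mulr1.
  by move: (sqnorm z) (cmod w ^+ 2) w2 => a b; lra.
have dh (w : C) : differentiable h w.
  apply: (differentiable_fcomp (g := twist lam)); first exact: differentiable_line.
  exact: differentiable_twist.
have M0 : 0 <= M by exact: expR_ge0.
have h0M : cmod (h 0) <= M by apply: hM; rewrite cmod0.
have key (w : C) : cmod w <= 1 -> cmod (h w - h 0) <= 2 * M * cmod w.
  apply: (@schwarz R (fun w : C => h w - h 0)) w => [|w _||w w1].
  - by rewrite mulr_ge0.
  - by apply: differentiable_add_cst; exact: dh.
  - by rewrite subrr.
  - rewrite (le_trans (cmodD _ _)) // cmodN mulr2n mulrDl mul1r.
    exact: lerD (hM w w1) h0M.
have := key (toC s); rewrite cmod_toC (gtr0_norm s0) => /(_ s1).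
by rewrite /h su scale0r addr0.
Qed.

Let egauss z := expR (pi * sqnorm z / 2).

(** By [cmod_twist], [gauss_sup] times [egauss] is the supremum of the moduli of all twists, so an
    increment bound uniform in [lam] passes to it. *)
Lemma gauss_sup_expR_le z w B : 0 <= B ->
  (forall lam, S lam -> cmod (twist lam w - twist lam z) <= B) ->
  gauss_sup w * egauss w <= gauss_sup z * egauss z + B.
Proof.
move=> B0 H; rewrite -ler_pdivlMr ?expR_gt0 //; apply: gauss_sup_le => lam Sl.
rewrite ler_pdivlMr ?expR_gt0 // -cmod_twist.
rewrite -[twist lam w](subrK (twist lam z)) (le_trans (cmodD _ _)) // addrC lerD ?H //.
by rewrite cmod_twist ler_wpM2r ?expR_ge0 // gauss_le_sup.
Qed.

(** As F vanishes on S, [gauss_sup] vanishes at 0; the Lipschitz estimate with base point 0, whose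
    constant is 2 e^pi, then bounds the growth. *)
Lemma gauss_sup_bound z : (forall lam, S lam -> F lam = 0) -> sqnorm z <= 1 ->
  gauss_sup z <= 2 * expR pi * Num.sqrt (sqnorm z).
Proof.
move=> FS z1.
have : gauss_sup z * egauss z <= gauss_sup 0 * egauss 0 + 2 * expR pi * Num.sqrt (sqnorm z).
  apply: gauss_sup_expR_le; first by rewrite !mulr_ge0 ?expR_ge0 ?sqrtr_ge0.
  move=> lam _; have := twist_lipschitz lam 0 z1.
  by rewrite add0r sqnorm0 add0r mulr1.
have -> : gauss_sup 0 = 0.
  apply/eqP; rewrite eq_le gauss_sup_ge0 andbT; apply: gauss_sup_le => lam Sl.
  by rewrite /gauss add0r FS // cmod0 mul0r.
rewrite mul0r add0r; apply: le_trans; rewrite ler_peMr ?gauss_sup_ge0 //.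
by rewrite -expR0 ler_expR divr_ge0 // mulr_ge0 ?pi_ge0 ?sqnorm_ge0.
Qed.

Lemma continuous_gauss_sup z : {for z, continuous gauss_sup}.
Proof.
have cexp2 y : {for y, continuous (fun z => expR (- (pi * sqnorm z / 2)))}.
  apply: (continuous_fcomp (g := expR)); last exact: continuous_expR.
  have -> : (fun z : V => - (pi * sqnorm z / 2)) = fun z : V => - (pi / 2) * sqnorm z.
    by apply/funext => y'; rewrite mulNr mulrAC.
  apply: continuous_cst_mul; exact: continuous_sqnorm.
have -> : gauss_sup = fun z => gauss_sup z * egauss z * expR (- (pi * sqnorm z / 2)).
  by apply/funext => y; rewrite -mulrA -expRD subrr expR0 mulr1.
apply: continuous_mul; last exact: cexp2.
apply: (iffRL (@cvgrPdist_lt _ _ _ (nbhs z) _ _ _)) => e e0.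
(* The Lipschitz constant depends on the base point, and both z and w serve as one; D works for both
   because |w|^2 <= 2|z|^2 + 2. *)
pose D := 2 * expR (pi * (2 * sqnorm z + 3)).
have D0 : 0 < D by rewrite mulr_gt0 // expR_gt0.
have d0 : 0 < Num.min 1 ((e / D) ^+ 2) by rewrite lt_min ltr01 exprn_gt0 // divr_gt0.
apply: filterS (near_sqnorm z d0) => w; rewrite lt_min => /andP[h1 h2].
have hD : D * Num.sqrt (sqnorm (w - z)) < e.
  rewrite mulrC -ltr_pdivlMr // -(@ltr_pXn2r _ 2%N) ?nnegrE ?sqrtr_ge0 ?(ltW (divr_gt0 e0 D0)) //.
  by rewrite sqr_sqrtr // sqnorm_ge0.
have hle y : sqnorm y <= 2 * sqnorm z + 2 -> 2 * expR (pi * (sqnorm y + 1)) <= D.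
  move=> hy; rewrite ler_pM2l // ler_expR ler_pM2l ?pi_gt0 //.
  have -> : 2 * sqnorm z + 3 = (2 * sqnorm z + 2) + 1 :> R by ring.
  by rewrite lerD2r.
have sz := sqnorm_ge0 z.
have zw : z + (w - z) = w by rewrite addrC subrK.
have wzE : w + (z - w) = z by rewrite addrC subrK.
have B0 : 0 <= D * Num.sqrt (sqnorm (w - z)) by rewrite mulr_ge0 ?(ltW D0) ?sqrtr_ge0.
have wz : sqnorm (z - w) = sqnorm (w - z).
  by rewrite -[z - w]opprB -scaleN1r sqnormZ cmodN cmod1 expr1n mul1r.
have a1 : gauss_sup w * egauss w <= gauss_sup z * egauss z + D * Num.sqrt (sqnorm (w - z)).
  apply: gauss_sup_expR_le => // lam _.
  have := twist_lipschitz lam z (ltW h1); rewrite zw => /le_trans; apply.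
  rewrite ler_wpM2r ?sqrtr_ge0 // hle //; lra.
have a2 : gauss_sup z * egauss z <= gauss_sup w * egauss w + D * Num.sqrt (sqnorm (w - z)).
  apply: gauss_sup_expR_le => // lam _; rewrite -wz.
  have := twist_lipschitz lam w (v := z - w); rewrite wz wzE => /(_ (ltW h1)) /le_trans; apply.
  rewrite ler_wpM2r ?sqrtr_ge0 // hle //.
  have := sqnormD_le z (w - z); rewrite zw; lra.
by apply: le_lt_trans hD; rewrite ler_distl lerBlDr a1 a2.
Qed.

End GaussianSup.

(** * Elementary inequalities for the local estimate *)

Section RealBounds.
Context {R : realType}.
Implicit Types (c e t x y g r K D E N : R).

Lemma div_sqrD1_gt0 e K : 0 < e -> 0 < e / (K ^+ 2 + 1).
Proof. by move=> e0; rewrite divr_gt0 // ltr_wpDl // sqr_ge0. Qed.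

Lemma div_sqrD1_le e K D x : 0 < e -> 0 <= D -> D <= K * x ->
  e / (K ^+ 2 + 1) * D ^+ 2 <= e * x ^+ 2.
Proof.
move=> e0 D0 DK; have K1 : 0 < K ^+ 2 + 1 by rewrite ltr_wpDl // sqr_ge0.
rewrite -mulrA ler_pM2l // mulrC ler_pdivrMr //.
have h1 : D ^+ 2 <= K ^+ 2 * x ^+ 2.
  by rewrite -exprMn ler_pXn2r ?nnegrE // (le_trans D0).
by apply: le_trans h1 _; rewrite mulrC ler_wpM2l ?sqr_ge0 // lerDl.
Qed.

Lemma lt_of_le_mul K D x r : 0 <= K -> 0 <= x -> D <= K * x -> x < r / (K + 1) -> D < r.
Proof.
move=> K0 x0 DK; rewrite ltr_pdivlMr ?ltr_wpDl // mulrC => xr.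
by apply: le_lt_trans DK (le_lt_trans _ xr); rewrite ler_wpM2r // lerDl.
Qed.

Lemma min3_gt0 r x y K : 0 < r -> 0 < x -> 0 < y -> 0 <= K ->
  0 < Num.min r (Num.min x (y / (K + 1))).
Proof. by move=> r0 x0 y0 K0; rewrite !lt_min r0 x0 divr_gt0 // ltr_wpDl. Qed.

Lemma sqrt_div_lt c N E : 0 < c -> 0 < E -> 0 <= N -> c < N ^+ 2 * E ->
  Num.sqrt (c / E) < N.
Proof.
move=> c0 E0 N0 cN; rewrite -(@ltr_pXn2r _ 2%N) ?nnegrE ?sqrtr_ge0 // sqr_sqrtr.
  by rewrite ltr_pdivrMr.
by rewrite divr_ge0 // ltW.
Qed.

Lemma sqrt_div_lt_le c E g : 0 < c -> 0 < E -> 0 <= g -> Num.sqrt (c / E) < g ->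
  c <= g ^+ 2 * E.
Proof.
move=> c0 E0 g0 cg; rewrite -ler_pdivrMr // -[leLHS]sqr_sqrtr ?divr_ge0 ?ltW //.
by rewrite ltr_pXn2r ?nnegrE ?sqrtr_ge0.
Qed.

(** In its use y and y0 are psi at [g v] and z, s is the real part of the holomorphic Taylor
    polynomial, x = |d|^2, t = Re <d, z> and x0 = |z|^2. The term -2 pi t cancels the cross term of
    |z + d|^2. *)
Lemma lifted_exponent (y y0 s t x x0 B D : R) :
  `|y - y0 - s - pi * x| <= B -> B <= D ->
  y0 - pi * x0 + (s - 2 * pi * t) + pi * (x + 2 * t + x0) <= y + D.
Proof.
move=> /ler_normlP[h1 _] h2.
have -> : y0 - pi * x0 + (s - 2 * pi * t) + pi * (x + 2 * t + x0) = y0 + s + pi * x by ring.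
by move: h1 h2; move: (pi * x) => p; lra.
Qed.

Lemma cmod_mul_cexp_sqr (u w : Cplx R) g e c : cmod u = g * expR (e / 2) ->
  cmod (u * cexp (toC 2^-1 * (toC c + w))) ^+ 2 = g ^+ 2 * expR (c + ReC w + e).
Proof.
move=> uE; rewrite cmodM uE cmod_cexp !exprMn -!expRM_natr -[LHS]mulrA -expRD.
congr (_ * expR _); rewrite ReCM ReC_toC ImC_toC mul0r subr0 ReCD ReC_toC.
by move: (ReC w) => x; field.
Qed.

Lemma quadratic_at0 n (l : 'I_n -> Cplx R) (Q : 'I_n -> 'I_n -> Cplx R) (z : 'rV[Cplx R]_n) (b : Cplx R) :
  \sum_j l j * (0 : 'rV_n) 0 j + \sum_j \sum_k Q j k * (0 : 'rV_n) 0 j * (0 : 'rV_n) 0 k +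
  b * herm 0 z = 0.
Proof.
have z0 j : (0 : 'rV[Cplx R]_n) 0 j = 0 by rewrite mxE.
have -> : herm 0 z = 0 by rewrite /herm big1 // => j _; rewrite z0 mul0r.
rewrite mulr0 addr0 big1 => [|j _]; last by rewrite !z0 mulr0.
rewrite add0r big1 // => j _; rewrite big1 // => k _; by rewrite !z0 mulr0.
Qed.

End RealBounds.

(** * Log-subharmonicity along local lifts of a disk *)

Section LiftedPotential.
Context {R : realType} {n : nat}.
Local Notation C := (Cplx R).
Local Notation V := 'rV[C]_n.

Lemma differentiable_lipschitz (g : C -> V) (p : C) : differentiable g p ->
  exists K : R, 0 <= K /\ exists2 r : R, 0 < r &
    forall v, cmod (v - p) < r -> rnorm (g v - g p) <= K * cmod (v - p).
Proof.
move=> /derivable1_diffP /cvg_ex[l /= gl]; exists (rnorm l + 1).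
split; first by rewrite addr_ge0 ?rnorm_ge0.
have ball1 : \forall q \near l, rnorm (q - l) < 1 by apply/near_rnormP; exists 1.
have /nearCP[d d0 D] : \forall h \near (0 : C), h != 0 ->
    rnorm (h^-1 *: (g (h%:A + p) - g p) - l) < 1.
  exact: (gl _ ball1).
exists d => // v vd; have [->|vp] := eqVneq v p.
  by rewrite !subrr cmod0 mulr0 -(scale0r (0 : V)) rnormZ cmod0 mul0r.
have h0 : v - p != 0 by rewrite subr_eq0.
have := D (v - p); rewrite subr0 => /(_ vd h0).
rewrite [(v - p)%:A]mulr1 subrK => /ltW q1.
have -> : g v - g p = (v - p) *: ((v - p)^-1 *: (g v - g p)).
  by rewrite scalerA divff // scale1r.
rewrite rnormZ mulrC ler_wpM2r ?cmod_ge0 //.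
rewrite -[_^-1 *: _](subrK l) (le_trans (rnormD _ _)) // addrC lerD2l //.
Qed.

Lemma near_log_subharmonic (E1 E2 : C -> R) (p : C) :
  (\forall v \near p, E1 v = E2 v) -> log_subharmonic_at E1 p -> log_subharmonic_at E2 p.
Proof.
move=> /nearCP[d d0 D] H e e0; have [rad rad0 {}H] := H e e0.
exists (Num.min rad d); first by rewrite lt_min rad0 d0.
move=> c c0; rewrite -D; last by rewrite subrr cmod0.
move=> cE; have [G [G1 G2 G3 G4]] := H c c0 cE; exists G; split.
- by move=> v vp; rewrite lt_min => /andP[vr _]; exact: G1 vp vr.
- exact: G2.
- exact: G3.
- by move=> v; rewrite lt_min => /andP[vr vd]; rewrite -(D v vd); exact: G4 vr.
Qed.

Variables (F : V -> C) (S : set V).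
Hypotheses (dF : forall z, differentiable F z)
  (F1 : forall z, cmod (F z) ^+ 2 * expR (- (pi * sqnorm z)) <= 1) (S0 : S 0).

Lemma continuous_lifted (g : C -> V) (psi : V -> R) p : {for p, continuous g} ->
  {for g p, continuous psi} ->
  {for p, continuous (fun v => gauss_sup F S (g v) ^+ 2 * expR (psi (g v)))}.
Proof.
move=> cg cp.
have c1 : {for p, continuous (fun v => gauss_sup F S (g v))}.
  by apply: (continuous_fcomp (g := gauss_sup F S)) cg _; exact: continuous_gauss_sup.
have c2 : {for p, continuous (fun v => psi (g v))} by exact: continuous_fcomp cg cp.
apply: (continuous_mul (continuous_mul c1 c1)).
by apply: (continuous_fcomp (g := expR)) c2 _; exact: continuous_expR.
Qed.

(* With the Taylor polynomial of psi absorbed in a holomorphic exponent, each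
   |twist lam|^2 e^(psi - pi|z|^2) becomes |G|^2 up to e^(o(|v - p|^2)). *)
Lemma log_subharmonic_lifted (W : set V) (g : C -> V) (psi : V -> R) p :
  open W -> smooth_on W psi -> W (g p) -> ddc psi (g p) = std_kahler (g p) ->
  (\forall v \near p, differentiable g v) ->
  log_subharmonic_at (fun v => gauss_sup F S (g v) ^+ 2 * expR (psi (g v))) p.
Proof.
move=> oW sm Wz dd /nearCP[r1 r10 dg] e e0.
have dgp : differentiable g p by apply: dg; rewrite subrr cmod0.
have [K [K0 [r2 r20 lip]]] := differentiable_lipschitz dgp.
set z := g p in Wz dd lip *.
have [l [Q T]] := taylor_kahler oW sm Wz dd.
(* The Taylor error is measured in |g v - z| <= K|v - p|; dividing e by K^2 + 1 converts it to e|v -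
   p|^2. *)
have [r3 r30 {}T] := T _ (div_sqrD1_gt0 K e0).
exists (Num.min r1 (Num.min r2 (r3 / (K + 1)))); first exact: min3_gt0 r10 r20 r30 K0.
move=> c c0 cE; have E0 : 0 < expR (psi z) by exact: expR_gt0.
have N0 := gauss_sup_ge0 F1 S0 z.
(* The supremum need not be attained: the strict inequality c < E p selects a translate that is good
   enough at p. *)
have [lam Sl lamc] := gauss_sup_gt F1 S0 (sqrt_div_lt c0 E0 N0 cE).
pose c1 := psi z - pi * sqnorm z.
pose q (d : V) : C := \sum_j l j * d 0 j + \sum_j \sum_k Q j k * d 0 j * d 0 k.
(* Besides the Taylor polynomial q of psi, the exponent removes the cross term 2 pi Re <g v - z, z>
   of pi|g v|^2. *)
pose a v : C := q (g v - z) + toC (- (2 * pi)) * herm (g v - z) z.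
pose G v : C := twist F lam (g v) * cexp (toC 2^-1 * (toC c1 + a v)).
have cmodG v : cmod (G v) ^+ 2 = gauss F (g v + lam) ^+ 2 *
    expR (c1 + ReC (a v) + pi * sqnorm (g v)).
  exact: cmod_mul_cexp_sqr (cmod_twist _ _ _).
have dG v : cmod (v - p) < r1 -> differentiable G v.
  move=> vr; have dv := dg v vr.
  have dj j : differentiable (fun v => (g v - z) 0 j) v.
    apply: (differentiable_coord_comp (g := fun v => g v - z)).
    exact: differentiable_add_cst.
  apply: differentiable_mul.
    apply: (differentiable_fcomp (g := twist F lam)) dv _.
    exact: differentiable_twist.
  apply: (differentiable_fcomp (g := cexp)); last exact: differentiable_cexp.
  apply: differentiable_cst_mul; apply: differentiable_cst_add.
  apply: differentiable_add; last first.
    apply: differentiable_cst_mul; apply: differentiable_fsum => j.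
    exact: differentiable_mul (dj j) (differentiable_cst _ _).
  apply: differentiable_add; apply: differentiable_fsum => j.
    exact: differentiable_cst_mul (dj j).
  apply: differentiable_fsum => k.
  exact: differentiable_mul (differentiable_cst_mul _ (dj j)) (dj k).
have a0 : a p = 0.
  by rewrite /a -/z subrr; exact: quadratic_at0.
exists G; split.
- by move=> v _; rewrite lt_min => /andP[vr _]; exact: dG.
- by apply: differentiable_continuous; apply: dG; rewrite subrr cmod0.
- rewrite cmodG a0 -/z.
  have -> : c1 + ReC (0 : C) + pi * sqnorm z = psi z by rewrite /c1 addr0 subrK.
  exact: sqrt_div_lt_le c0 E0 (gauss_ge0 _ _) lamc.
move=> v; rewrite !lt_min => /and3P[v1 v2 v3].
set d := g v - z; have gE : g v = z + d by rewrite addrC subrK.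
have dK : rnorm d <= K * cmod (v - p) by exact: lip v2.
have dr : rnorm d < r3 by exact: lt_of_le_mul K0 (cmod_ge0 _) dK v3.
have Tv := T d dr; rewrite -gE in Tv.
have err := div_sqrD1_le e0 (rnorm_ge0 d) dK.
rewrite cmodG -[leRHS]mulrA -expRD; apply: ler_pM (sqr_ge0 _) (expR_ge0 _) _ _.
  exact: lerXn2r (gauss_ge0 _ _) (gauss_sup_ge0 F1 S0 _) (gauss_le_sup F1 _ Sl).
rewrite ler_expR.
have -> : sqnorm (g v) = sqnorm d + 2 * ReC (herm d z) + sqnorm z.
  by rewrite gE addrC sqnormD.
have -> : ReC (a v) = ReC (q d) - 2 * pi * ReC (herm d z).
  by rewrite /a -/d ReCD ReCM ReC_toC ImC_toC mul0r subr0 mulNr.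
exact: lifted_exponent Tv err.
Qed.

End LiftedPotential.

(** * The quasi-plurisubharmonic function on the torus *)

Section LogPotential.
Context {R : realType}.
Local Open Scope ereal_scope.

Lemma lne_lt (x a : R) : (0 <= x)%R -> (lne x%:E < a%:E) = (x < expR a)%R.
Proof.
move=> x0; have [->|xn0] := eqVneq x 0%R; first by rewrite le0_lneNy // ltNyr expR_gt0.
have xp : (0 < x)%R by rewrite lt_def xn0.
by rewrite lne_EFin // lte_fin -[in LHS]ltr_expR lnK ?posrE.
Qed.

Lemma lneD (x s : R) : (0 <= x)%R -> lne x%:E + s%:E = lne (x * expR s)%:E.
Proof.
move=> x0; have [->|xn0] := eqVneq x 0%R; first by rewrite mul0r le0_lneNy.
have xp : (0 < x)%R by rewrite lt_def xn0.
by rewrite !lne_EFin ?mulr_gt0 ?expR_gt0 // lnM ?posrE ?expR_gt0 // expRK.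
Qed.

Lemma lne_lty (x : R) : lne x%:E < +oo.
Proof. by rewrite /lne; case: ifP => _; rewrite ?ltNyy ?ltry. Qed.

Lemma usc_lne (T : topologicalType) (E : T -> R) t : (forall t, 0 <= E t)%R ->
  {for t, continuous E} -> usc_at (fun t => lne (E t)%:E) t.
Proof.
move=> E0 cE a; rewrite lne_lt // => lt.
have e0 : (0 < expR a - E t)%R by rewrite subr_gt0.
have nb : \forall y \near t, (`|E t - E y| < expR a - E t)%R.
  exact: (@cvgrPdist_lt _ _ _ (nbhs t) _ E (E t)).1 cE _ e0.
apply: (@filterS _ (nbhs t) _ _ _ _ nb) => y; rewrite lne_lt // ltr_norml; lra.
Qed.

(** From log x <= log M + log y and log y < 0 the quotient is at least 1 + log M / log y, and the
    third bound on y makes this at least g. For x = 0 the quotient is +oo. *)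
Lemma log_quotient_ge (M g x y : R) : (0 < M)%R -> (0 <= g)%R -> (g < 1)%R ->
  (0 < y)%R -> (y < expR (- 1))%R -> (y < expR (- (ln M / (1 - g))))%R ->
  (0 <= x)%R -> (x <= M * y)%R -> g%:E <= lne x%:E / (ln y)%:E.
Proof.
move=> M0 g0 g1 y0 y1 yM x0 xM.
have ly : (ln y < 0)%R.
  by rewrite -ltr_expR lnK // expR0 (lt_trans y1) // expR_lt1 ltrN10.
have g1' : (0 < 1 - g)%R by rewrite subr_gt0.
rewrite inver lt_eqF //; have [->|xn0] := eqVneq x 0%R.
  by rewrite le0_lneNy // lt0_mulNye ?leey // lte_fin invr_lt0.
have xp : (0 < x)%R by rewrite lt_def xn0.
rewrite lne_EFin // -EFinM lee_fin ler_ndivlMr //.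
have : (ln x <= ln M + ln y)%R by rewrite -lnM ?posrE // ler_ln ?posrE ?mulr_gt0.
have : (ln y < - (ln M / (1 - g)))%R by rewrite -ltr_expR lnK.
rewrite ltrNr ltr_pdivrMr // mulNr; lra.
Qed.

End LogPotential.

Section TorusPotential.
Context {R : realType} {n : nat} {L : lattice R (n + n)}.
Local Notation C := (Cplx R).
Local Notation V := 'rV[C]_n.
Local Notation X := (torus L).
Variable F : V -> C.
Hypotheses (dF : forall z, differentiable F z)
  (F1 : forall z, cmod (F z) ^+ 2 * expR (- (pi * sqnorm z)) <= 1).
Let N := gauss_sup F (lattice_C L).
Let N0 z : 0 <= N z. Proof. exact: gauss_sup_ge0 F1 (lattice_C0 L) z. Qed.

(** Translating by a lattice vector only reindexes the supremum. *)
Lemma gauss_sup_periodic z w : torus_proj L z = torus_proj L w -> N z = N w.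
Proof.
have le a b : lattice_C L (a - b) -> N a <= N b.
  move=> ab; apply: (gauss_sup_le (lattice_C0 L)) => lam Ll.
  have -> : a + lam = b + (a - b + lam) by rewrite addrA [b + _]addrC subrK.
  exact: (gauss_le_sup F1 b (lattice_CD ab Ll)).
move=> /torus_projP zw; apply/eqP; rewrite eq_le le //=; apply: le.
by rewrite -opprB; exact: lattice_CN.
Qed.

Definition log_gauss_sup (p : X) : \bar R := lne (N (torus_repr p) ^+ 2)%:E.

Lemma gauss_sup_repr z : N (torus_repr (torus_proj L z)) = N z.
Proof. by apply: gauss_sup_periodic; rewrite torus_reprK. Qed.

Lemma log_gauss_sup_proj z : log_gauss_sup (torus_proj L z) = lne (N z ^+ 2)%:E.
Proof. by rewrite /log_gauss_sup gauss_sup_repr. Qed.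

Lemma usc_log_gauss_sup p : usc_at log_gauss_sup p.
Proof.
apply: (usc_lne (E := fun p : X => N (torus_repr p) ^+ 2)) => [q|].
  exact: sqr_ge0.
have cN : continuous (fun p : X => N (torus_repr p)).
  apply/quotient_continuous => z.
  have -> : (fun p : X => N (torus_repr p)) \o \pi_X%qT = N.
    by apply/funext => y; exact: gauss_sup_repr.
  exact: (continuous_gauss_sup dF F1 (lattice_C0 L)).
exact: (continuous_mul (cN p) (cN p)).
Qed.

(** Continuity and [log_subharmonic_at] are local, so each point may use its own lift g. All lifts
    describe the same E, because [gauss_sup] is periodic and psi lives on the torus. *)
Lemma log_gauss_sup_submean (U : set X) (psi : X -> R) (f : C -> X) :
  local_potential (torus_kahler (L := L)) U psi -> embedded_disk f ->
  f @` open_disk 0 1 `<=` U ->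
  subharmonic_on (open_disk 0 1) (fun w => log_gauss_sup (f w) + (psi (f w))%:E)%E.
Proof.
move=> [oU smpsi ddpsi] [lift _ _] fU.
pose E w := N (torus_repr (f w)) ^+ 2 * expR (psi (f w)).
have E0 w : 0 <= E w by rewrite mulr_ge0 ?sqr_ge0 ?expR_ge0.
have -> : (fun w => log_gauss_sup (f w) + (psi (f w))%:E)%E = fun w => lne (E w)%:E.
  by apply/funext => w; rewrite /log_gauss_sup lneD ?sqr_ge0.
pose W := torus_proj L @^-1` U; pose psit := psi \o torus_proj L.
have oW : open W by exact: oU.
have loc w : open_disk 0 1 w -> {for w, continuous E} /\ log_subharmonic_at E w.
  move=> dw; have [g gf dg] := lift w dw.
  have gw : torus_proj L (g w) = f w by exact: nbhs_singleton gf.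
  have Wg : W (g w) by rewrite /W /= gw; apply: fU; exists w.
  have ddg : ddc psit (g w) = std_kahler (g w).
    by rewrite -(torus_kahlerE (L := L)); apply: ddpsi.
  have dgw : \forall v \near w, differentiable g v.
    by apply: filterS dg => v [/derivable1_diffP].
  have EE : \forall v \near w, N (g v) ^+ 2 * expR (psit (g v)) = E v.
    apply: filterS gf => v gv; rewrite /E /psit /= -gv; congr (_ ^+ 2 * _).
    by rewrite gauss_sup_repr.
  split; last first.
    apply: near_log_subharmonic EE _.
    exact: (log_subharmonic_lifted dF F1 (lattice_C0 L) oW smpsi Wg ddg dgw).
  have cE1 : {for w, continuous (fun v => N (g v) ^+ 2 * expR (psit (g v)))}.
    apply: (continuous_lifted dF F1 (lattice_C0 L)).
      apply: differentiable_continuous; exact: nbhs_singleton dgw.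
    exact: (smpsi 0%N).1 Wg.
  have EEw := nbhs_singleton EE; rewrite /= in EEw.
  apply/continuousCR_deltaP => e e0.
  have [d1 d10 D1] := (continuousCR_deltaP _ w).1 cE1 e e0.
  have [d2 d20 D2] := (nearCP _ w).1 EE.
  exists (Num.min d1 d2); first by rewrite lt_min d10 d20.
  move=> v; rewrite lt_min => /andP[v1 v2].
  by rewrite -EEw -(D2 v v2); exact: D1.
have disk w : cmod (w - 0) < 1 -> open_disk (0 : C) 1 w.
  by rewrite /open_disk /= normC_cmod toC_lt.
split.
- by move=> w _; exact: lne_lty.
- by move=> w /loc[cE _]; exact: usc_lne.
move=> a r r0 ar.
have inU v : cmod (v - a) <= r -> open_disk (0 : C) 1 v.
  by move=> va; apply: ar; rewrite /closed_disk /= normC_cmod toC_le.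
apply: submean_of_prod => //.
- by move=> v /inU/loc[].
move=> M M0.
(* The rotations are the M-th roots of unity. At w1 = 0 every factor is E a, so the left-hand
   product is E a ^ M. *)
have := @log_subharmonic_max R E a r M (fun k => cis (k%:R * (2 * pi / M%:R))) 0 r0.
case.
- by move=> v _; exact: E0.
- by move=> v /inU/loc[].
- by move=> v va; have [] := loc v (inU v (ltW va)).
- by move=> k; exact: cmod_cis.
- by rewrite cmod0 ltW.
move=> w wr H; exists w => //; apply: le_trans H.
under eq_bigr => k _ do rewrite mulr0 addr0.
by rewrite prodr_const card_ord.
Qed.

Lemma PSH_log_gauss_sup z : F z != 0 -> PSH (torus_kahler (L := L)) log_gauss_sup.
Proof.
move=> Fz; split.
- by move=> p; exact: lne_lty.
- exact: usc_log_gauss_sup.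
- exists (torus_proj L z); rewrite log_gauss_sup_proj lne_EFin // exprn_gt0 //.
  apply: lt_le_trans (gauss_le_sup F1 z (lattice_C0 L)); rewrite addr0.
  by rewrite /gauss mulr_gt0 ?expR_gt0 // cmod_gt0.
- exact: log_gauss_sup_submean.
Qed.

Lemma lelong_log_gauss_sup (gam : R) : (forall z, lattice_C L z -> F z = 0) ->
  0 <= gam -> gam < 1 -> (gam%:E <= lelong log_gauss_sup (torus_proj L 0))%E.
Proof.
move=> FL g0 g1; rewrite /lelong limf_einfE.
pose M := (2 * expR pi) ^+ 2 : R.
have M0 : 0 < M by rewrite exprn_gt0 // mulr_gt0 // expR_gt0.
pose d := Num.min (expR (- 1)) (expR (- (ln M / (1 - gam)))).
have d0 : 0 < d by rewrite lt_min !expR_gt0.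
pose q := torus_proj L 0.
pose h z := (log_gauss_sup (torus_proj L (torus_repr q + z)) / (ln (sqnorm z))%:E)%E.
have near_h : \forall z \near (0 : V)^', (gam%:E <= h z)%E.
  suff : \forall z \near (0 : V), z != 0 -> (gam%:E <= h z)%E by [].
  apply: filterS (near_sqnorm (0 : V) d0) => z; rewrite subr0 lt_min => /andP[z1 z2] zn0.
  have zp : 0 < sqnorm z.
    by rewrite lt_def sqnorm_ge0 andbT; apply: contra_neq zn0; exact: sqnorm_eq0.
  rewrite /h log_gauss_sup_proj.
  (* [torus_repr q] is a lattice point that need not be 0; periodicity removes it. *)
  have -> : N (torus_repr q + z) = N z.
    apply: gauss_sup_periodic; apply/torus_projP; rewrite addrK -[torus_repr q]subr0.
    by apply/torus_projP; rewrite torus_reprK.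
  have zle1 : sqnorm z <= 1.
    by rewrite ltW // (lt_trans z1) // expR_lt1 oppr_lt0.
  have Nz := gauss_sup_bound dF F1 (lattice_C0 L) FL zle1.
  apply: (log_quotient_ge M0 g0 g1 zp z1 z2 (sqr_ge0 _)).
  have -> : M * sqnorm z = (2 * expR pi * Num.sqrt (sqnorm z)) ^+ 2.
    by rewrite exprMn sqr_sqrtr // sqnorm_ge0.
  by apply: lerXn2r Nz; rewrite nnegrE ?N0 // !mulr_ge0 ?expR_ge0 ?sqrtr_ge0.
(* The lower limit is a supremum of infima over neighbourhoods, so a single good neighbourhood
   suffices. *)
apply: le_trans (ereal_sup_ubound _); last by exists [set z | (gam%:E <= h z)%E].
by apply: le_ereal_inf_tmp => _ [z hz <-].
Qed.


End TorusPotential.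

Theorem proposition2p2 (R : realType) (n : nat) (L : lattice R (n + n)%N) :
  (psef_threshold (torus_proj L 0%R) (torus_kahler (L := L)) < 1%:E)%E ->
  uniqueness_set (lattice_C L).
Proof.
move=> thr F dF supF FL z; apply: contrapT => Fz.
have F1 w : cmod (F w) ^+ 2 * expR (- (pi * sqnorm w)) <= 1.
  rewrite cmod_sqr -lee_fin; apply: le_trans supF; apply: ereal_sup_ubound.
  by exists w.
have psh := PSH_log_gauss_sup (L := L) dF F1 (introN eqP Fz).
move: thr; apply/negP; rewrite -leNgt; apply/lee_subgt0Pr => e e0.
have ge gam : 0 <= gam -> gam < 1 ->
    (gam%:E <= psef_threshold (torus_proj L 0%R) (torus_kahler (L := L)))%E.
  move=> g0 g1; apply: ereal_sup_ubound; exists gam => //=; split => //.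
  by exists (log_gauss_sup (L := L) F) => //; exact: lelong_log_gauss_sup.
(* The exponent 1 - e is raised to 0 when e > 1, since the threshold admits only nonnegative
   exponents. *)
apply: le_trans (ge (Num.max 0 (1 - e)) _ _).
- by rewrite -EFinB lee_fin le_max lexx orbT.
- by rewrite le_max lexx.
- by rewrite gt_max ltr01 gtrBl.
Qed.
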